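(* In the setting of the context, let $U\subset M$ be open. Define recursively an action $\Phi'_U$ of homogeneous tensor fields in $\Gamma_U(T(E^{\mathcal B,\mathcal F}))$ on sections $s\in\Gamma_U(\mathcal S)$ by $\Phi'_U(f)s=fs$ in degree zero and: - for $(X^{\mathcal B},X^{\mathcal F})\in\Gamma_U(E^{\mathcal B,\mathcal F})$, $$\Phi'_U((X^{\mathcal B},X^{\mathcal F}))s=\nabla^{\mathcal S}_{X^{\mathcal B}}s+c(X^{\mathcal F})s;$$ - for $(X^{\mathcal B},X^{\mathcal F})\in\Gamma_U(E^{\mathcal B,\mathcal F})$ and arbitrary homogeneous tensor fields $Y_1,\dots,Y_k\in\Gamma_U(T(E^{\mathcal B,\mathcal F}))$, $$\Phi'_U\big((X^{\mathcal B},X^{\mathcal F})\otimes Y_1\otimes\cdots\otimes Y_k\big)s=\big(\nabla^{\mathcal S}_{X^{\mathcal B}}+c(X^{\mathcal F})\big)\big(\Phi'_U(Y_1\otimes\cdots\otimes Y_k)s\big)-\Phi'_U\big(\nabla^T_{X^{\mathcal B}}(Y_1\otimes\cdots\otimes Y_k)\big)s,$$ extended by linearity. Then $\Phi_U=\Phi'_U$. In particular, $\Phi'_U$ gives the same module structure on $\Gamma_U(\mathcal S)$ for the associative algebra $\Pi_U(T(E^{\mathcal B,\mathcal F}))$ as $\Phi_U$.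
   Context: **Courant algebroids.** A Courant algebroid on $M$ is a real vector bundle $E\to M$ with a nondegenerate symmetric bilinear form $h$, a bilinear operation $\circ$ on $\Gamma(E)$ and an anchor $\rho:E\to TM$ with, for $e_i\in\Gamma(E)$, $f\in C^\infty(M)$: $e_1\circ(e_2\circ e_3)=(e_1\circ e_2)\circ e_3+e_2\circ(e_1\circ e_3)$; $\rho(e_1\circ e_2)=[\rho(e_1),\rho(e_2)]$; $e_1\circ(fe_2)=(\rho(e_1)f)e_2+f(e_1\circ e_2)$; $\rho(e_1)h(e_2,e_3)=h(e_1\circ e_2,e_3)+h(e_2,e_1\circ e_3)$; $e_1\circ e_2+e_2\circ e_1=Dh(e_1,e_2)$, where $h(Df,e)=\rho(e)f$. It is transitive if $\rho$ is surjective. An $E$-connection on a bundle $F$ is an operation $\nabla_es$ with $\nabla_{fe}s=f\nabla_es$, $\nabla_e(fs)=(\rho(e)f)s+f\nabla_es$. A generalized metric is a bundle isomorphism $\mathcal G:E\to E$ with $\mathcal G^2=\mathrm{id}$, $h(\mathcal Gu,v)=h(u,\mathcal Gv)$ and $G(u,v)=h(\mathcal Gu,v)$ positive definite. A generalized Levi-Civita connection for $\mathcal G$ is an $E$-connection on $E$ preserving $h$ and $\mathcal G$ with vanishing torsion $T(e_1,e_2)=\nabla_{e_1}e_2-\nabla_{e_2}e_1-e_1\circ e_2+(\nabla e_1)^*e_2$ ($(\nabla e_1)^*$ the $h$-adjoint of $e\mapsto\nabla_ee_1$). **Geometric data.** $M$ is a smooth manifold; $E^{\mathcal B}$ a transitive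 Courant algebroid on $M$ with generalized metric $\mathcal G^{\mathcal B}$; $E^{\mathcal F}$ a copy with a Courant algebroid isomorphism $\iota:E^{\mathcal B}\to E^{\mathcal F}$ and generalized metric $\iota\mathcal G^{\mathcal B}\iota^{-1}$; $\nabla^{\mathcal B}$ a chosen generalized Levi-Civita connection for $\mathcal G^{\mathcal B}$; $\nabla^{\mathcal F}$ the $E^{\mathcal B}$-connection on $E^{\mathcal F}$ with $\nabla^{\mathcal F}_X(\iota Y)=\iota(\nabla^{\mathcal B}_XY)$. Everything is complexified, keeping notation. $E^{\mathcal B,\mathcal F}=E^{\mathcal B}\oplus E^{\mathcal F}$; $\nabla^T$ is the $E^{\mathcal B}$-connection on the tensor algebra bundle $T(E^{\mathcal B,\mathcal F})$ induced from $\nabla^{\mathcal B}\oplus\nabla^{\mathcal F}$ by the Leibniz rule; $\Pi_U$ denotes sections over $U$ parallel for $\nabla^T$, an associative algebra under $\otimes$. **Spinors.** The real bundle $E_{\mathbb R}$ underlying $E^{\mathcal F}$ has even rank and carries a fixed real Clifford module bundle $S_{0,\mathbb R}$ ($c(e)^2=h(e,e)$), absolutely irreducible: $\operatorname{End}_{\mathcal C\ell(E_{\mathbb R})}(S_{0,\mathbb R})=\mathbb R\,\mathrm{id}$ and $\mathcal C\ell(E_{\mathbb R},h)\cong\operatorname{End}_{\mathbb R}(S_{0,\mathbb R})$. With $|\det V^*|^s$ the line bundle of real $s$-densities on $V$ and $\mathrm{rk}=\operatorname{rank}S_{0,\mathbb R}$, $S_{\mathbb R}=S_{0,\mathbb R}\otimes|\det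 S_{0,\mathbb R}^*|^{1/\mathrm{rk}}$, with connection induced by any Clifford-compatible lift to $S_{0,\mathbb R}$ of the generalized connection $\nabla$ on $E_{\mathbb R}$ transported from $\nabla^{\mathcal B}$ (independent of the lift). $S=S_{\mathbb R}\otimes\mathbb C$ with a fixed global involution $J$, $J^2=\mathrm{id}$, $Jc(e)=-c(e)J$. $L=|\det T^*M|^{1/2}$ with $\nabla^L_v\mu=\mathcal L_{\rho(v)}\mu-\frac12\operatorname{tr}(\nabla v)\mu$. $\mathcal S=S\otimes L$, $\nabla^{\mathcal S}=\nabla^S\otimes\mathrm{id}+\mathrm{id}\otimes\nabla^L$; via $\iota$ on directions it is an $E^{\mathcal B}$-connection with $\nabla^{\mathcal S}_{e_1}(c(e_2)s)=c(\nabla^{\mathcal F}_{e_1}e_2)s+c(e_2)\nabla^{\mathcal S}_{e_1}s$ for $e_1\in\Gamma(E^{\mathcal B})$, $e_2\in\Gamma(E^{\mathcal F})$. **Action $\Phi_U$.** Let $\pi_{\mathcal B},\pi_{\mathcal F}$ be the projections of $E^{\mathcal B,\mathcal F}$ and $\nabla^{\mathcal B,\mathcal F}_Z:=\nabla^T_{\pi_{\mathcal B}Z}$. Put $\mathbb A_Zs=\nabla^{\mathcal S}_{\pi_{\mathcal B}Z}s+c(\pi_{\mathcal F}Z)s$, $\mathbb A^0s=s$ and recursively $$(\mathbb A^{k+1}s)(X_0,\dots,X_k)=\mathbb A_{X_0}\big((\mathbb A^ks)(X_1,\dots,X_k)\big)-\sum_{j=1}^k(\mathbb A^ks)(X_1,\dots,\nabla^{\mathcal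 B,\mathcal F}_{X_0}X_j,\dots,X_k).$$ Then $\Phi_U(X_1\otimes\cdots\otimes X_k)s=(\mathbb A^ks)(X_1,\dots,X_k)$, extended $C^\infty$-linearly to all tensor fields of degree $k$, $\Phi_U(f)s=fs$ in degree $0$, and additively to $\Gamma_U(T(E^{\mathcal B,\mathcal F}))$. It makes $\Gamma_U(\mathcal S)$ a module over $\Pi_U(T(E^{\mathcal B,\mathcal F}))$. *)

(* Defs.v *)
From HB Require Import structures.
From mathcomp Require Import all_boot all_order all_algebra.
From mathcomp Require Import all_classical all_reals all_analysis.
From mathcomp Require Import complex.

Set Implicit Arguments.
Unset Strict Implicit.
Unset Printing Implicit Defensive.

Import Order.TTheory GRing.Theory Num.Theory numFieldNormedType.Exports.
Local Open Scope classical_set_scope.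
Local Open Scope ring_scope.

Definition basis_vec {R : realType} {n : nat} (i : 'I_n) : 'cV[R]_n :=
  delta_mx i ord0.

Fixpoint is_Ck {R : realType} {n : nat} (k : nat) (V : set 'cV[R]_n)
    (f : 'cV[R]_n -> R) : Prop :=
  match k with
  | 0 => forall x, V x -> {for x, continuous f}
  | k'.+1 => (forall x v, V x -> derivable f x v) /\
             forall v, is_Ck k' V (fun x => 'D_v f x)
  end.

Definition is_Cinfty {R : realType} {n : nat} (V : set 'cV[R]_n)
    (f : 'cV[R]_n -> R) : Prop := forall k, is_Ck k V f.

Record chart (R : realType) (n : nat) (T : topologicalType) := Chart {
  cdom : set T;
  cfun :> T -> 'cV[R]_n;
  cinv : 'cV[R]_n -> T;
  cdom_open : open cdom;
  cimg_open : open (cfun @` cdom);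
  cfunK : forall x, cdom x -> cinv (cfun x) = x;
  cfun_cont : forall x, cdom x -> {for x, continuous cfun};
  cinv_cont : forall y, (cfun @` cdom) y -> {for y, continuous cinv} }.

(* As is usual for tangent bundles in coordinates, every point x comes with a
   preferred chart [mchart (mat x)] around it. *)
Record manifold (R : realType) (n : nat) := Manifold {
  mtop :> topologicalType;
  mtop_hausdorff : hausdorff_space mtop;
  mtop_countable : @second_countable mtop;
  mI : Type;
  mchart : mI -> chart R n mtop;
  mat : mtop -> mI;
  matP : forall x, cdom (mchart (mat x)) x;
  mcompat : forall (i j : mI) (k : 'I_n),
    is_Cinfty (mchart i @` (cdom (mchart i) `&` cdom (mchart j)))
              (fun y => mchart j (cinv (mchart i) y) k ord0) }.

(* Fields over an open set U are represented by total functions on M of which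
   only the values on U matter. *)
Definition eq_on {T V : Type} (U : set T) (s t : T -> V) : Prop :=
  forall x, U x -> s x = t x.

Section Geometry.
Context {R : realType} {n : nat} {M : manifold R n}.

Definition smooth_fun (U : set M) (f : M -> R) : Prop :=
  forall i : mI M, is_Cinfty (mchart i @` (U `&` cdom (mchart i)))
                             (f \o cinv (mchart i)).

(* The fibre T_xM is R^n through the preferred chart at x. *)
Definition vact (X : M -> 'cV[R]_n) (f : M -> R) : M -> R := fun x =>
  'D_(X x) (f \o cinv (mchart (mat x))) (mchart (mat x) x).

(* Each fibre of a rank r bundle is identified with R^r by some basis chosen
   point by point, with no regularity in the point; the smooth structure is
   carried by local frames, the columns of [bframe i x] being the values at x of
   the i-th one. *)
Record framing (r : nat) := Framing {
  bI : Type;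
  bdom : bI -> set M;
  bframe : bI -> M -> 'M[R]_r }.

Record vbundle (r : nat) := VBundle {
  vframing :> framing r;
  bdom_open : forall i : bI vframing, open (bdom i);
  bframe_unit : forall (i : bI vframing) x, bdom i x -> bframe i x \in unitmx;
  btrans : forall (i j : bI vframing) (k l : 'I_r),
    smooth_fun (bdom i `&` bdom j)
               (fun x => (invmx (bframe i x) *m bframe j x) k l);
  bat : M -> bI vframing;
  batP : forall x, bdom (bat x) x }.

Definition sec (r : nat) := M -> 'cV[R]_r.

Definition smooth_sec (r : nat) (E : framing r) (U : set M) (s : sec r) : Prop :=
  forall (i : bI E) (k : 'I_r),
    smooth_fun (U `&` bdom i) (fun x => (invmx (bframe i x) *m s x) k ord0).

Definition smooth_hom (p q : nat) (E : framing p) (F : framing q)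
    (T : M -> 'M[R]_(q, p)) : Prop :=
  forall (i : bI E) (j : bI F) (k : 'I_q) (l : 'I_p),
    smooth_fun (bdom i `&` bdom j)
               (fun x => (invmx (bframe j x) *m T x *m bframe i x) k l).

Definition smooth_form (r : nat) (E : framing r) (h : M -> 'M[R]_r) : Prop :=
  forall (i j : bI E) (k l : 'I_r),
    smooth_fun (bdom i `&` bdom j)
               (fun x => ((bframe i x)^T *m h x *m bframe j x) k l).

Definition sadd {r : nat} (s t : sec r) : sec r := fun x => s x + t x.
Definition sscale {r : nat} (f : M -> R) (s : sec r) : sec r :=
  fun x => f x *: s x.
Definition happ {p q : nat} (T : M -> 'M[R]_(q, p)) (s : sec p) : sec q :=
  fun x => T x *m s x.

(* The coordinate frame of the chart i, expressed in the preferred charts. *)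
Definition tangent_frame (i : mI M) (x : M) : 'M[R]_n :=
  \matrix_(k, l) 'D_(basis_vec l)
    (fun y => mchart (mat x) (cinv (mchart i) y) k ord0) (mchart i x).

Definition tangent : framing n :=
  @Framing n (mI M) (fun i => cdom (mchart i)) tangent_frame.

(* A density of weight s on V is a function mu on the bases of V such that
   mu(b A) = |det A|^s mu(b). The line |det V^*|^s of these is identified with R
   by evaluation at the basis used to identify V with R^r; the frame below is
   the density equal to 1 on the i-th frame of E. *)
Definition density (s : R) (r : nat) (E : framing r) : framing 1 :=
  @Framing 1 (bI E) (@bdom r E)
    (fun i x => (`|\det (bframe i x)| `^ (- s))%:M).

(* Tensor product with a line bundle; R^r (x) R is identified with R^r. *)
Definition line_tensor (r : nat) (E : framing r) (L : framing 1) : framing r :=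
  @Framing r (bI E * bI L)%type (fun i => bdom i.1 `&` bdom i.2)
    (fun i x => bframe i.2 x ord0 ord0 *: bframe i.1 x).

Definition stensor {r : nat} (s : sec r) (l : sec 1) : sec r :=
  fun x => l x ord0 ord0 *: s x.

(* The operations on sections are given over all open sets at once, as local
   operations compatible with restriction. *)
Record courant_algebroid (r : nat) := CourantAlgebroid {
  ca_bundle :> vbundle r;
  ca_h : M -> 'M[R]_r;
  ca_anchor : M -> 'M[R]_(n, r);
  ca_op : sec r -> sec r -> sec r;
  ca_D : (M -> R) -> sec r;
  ca_hval := fun (u v : sec r) x => ((u x)^T *m ca_h x *m v x) ord0 ord0;
  ca_act := fun (e : sec r) => vact (happ ca_anchor e);
  ca_h_sym : forall x, (ca_h x)^T = ca_h x;
  ca_h_nondeg : forall x, ca_h x \in unitmx;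
  ca_h_smooth : smooth_form ca_bundle ca_h;
  ca_anchor_smooth : smooth_hom ca_bundle tangent ca_anchor;
  ca_op_smooth : forall U e1 e2, open U ->
    smooth_sec ca_bundle U e1 -> smooth_sec ca_bundle U e2 ->
    smooth_sec ca_bundle U (ca_op e1 e2);
  ca_op_local : forall U e1 e1' e2 e2', open U ->
    smooth_sec ca_bundle U e1 -> smooth_sec ca_bundle U e1' ->
    smooth_sec ca_bundle U e2 -> smooth_sec ca_bundle U e2' ->
    eq_on U e1 e1' -> eq_on U e2 e2' ->
    eq_on U (ca_op e1 e2) (ca_op e1' e2');
  ca_op_linearl : forall U (a : R) e1 e1' e2, open U ->
    smooth_sec ca_bundle U e1 -> smooth_sec ca_bundle U e1' ->
    smooth_sec ca_bundle U e2 ->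
    eq_on U (ca_op (fun x => a *: e1 x + e1' x) e2)
            (fun x => a *: ca_op e1 e2 x + ca_op e1' e2 x);
  ca_op_linearr : forall U (a : R) e1 e2 e2', open U ->
    smooth_sec ca_bundle U e1 -> smooth_sec ca_bundle U e2 ->
    smooth_sec ca_bundle U e2' ->
    eq_on U (ca_op e1 (fun x => a *: e2 x + e2' x))
            (fun x => a *: ca_op e1 e2 x + ca_op e1 e2' x);
  ca_jacobi : forall U e1 e2 e3, open U ->
    smooth_sec ca_bundle U e1 -> smooth_sec ca_bundle U e2 ->
    smooth_sec ca_bundle U e3 ->
    eq_on U (ca_op e1 (ca_op e2 e3))
            (sadd (ca_op (ca_op e1 e2) e3) (ca_op e2 (ca_op e1 e3)));
  ca_bracket : forall U e1 e2 f, open U ->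
    smooth_sec ca_bundle U e1 -> smooth_sec ca_bundle U e2 ->
    smooth_fun U f ->
    eq_on U (ca_act (ca_op e1 e2) f)
            (fun x => ca_act e1 (ca_act e2 f) x - ca_act e2 (ca_act e1 f) x);
  ca_leibniz : forall U e1 e2 f, open U ->
    smooth_sec ca_bundle U e1 -> smooth_sec ca_bundle U e2 ->
    smooth_fun U f ->
    eq_on U (ca_op e1 (sscale f e2))
            (sadd (sscale (ca_act e1 f) e2) (sscale f (ca_op e1 e2)));
  ca_metric : forall U e1 e2 e3, open U ->
    smooth_sec ca_bundle U e1 -> smooth_sec ca_bundle U e2 ->
    smooth_sec ca_bundle U e3 ->
    eq_on U (ca_act e1 (ca_hval e2 e3))
            (fun x => ca_hval (ca_op e1 e2) e3 x + ca_hval e2 (ca_op e1 e3) x);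
  ca_DP : forall U f e, open U -> smooth_fun U f -> smooth_sec ca_bundle U e ->
    eq_on U (ca_hval (ca_D f) e) (ca_act e f);
  ca_symm : forall U e1 e2, open U ->
    smooth_sec ca_bundle U e1 -> smooth_sec ca_bundle U e2 ->
    eq_on U (sadd (ca_op e1 e2) (ca_op e2 e1)) (ca_D (ca_hval e1 e2)) }.

Definition transitive_ca (r : nat) (E : courant_algebroid r) : Prop :=
  forall (x : M) (v : 'cV[R]_n), exists u : 'cV[R]_r, ca_anchor E x *m u = v.

Record courant_iso (r : nat) (E F : courant_algebroid r) (iota : M -> 'M[R]_r)
    : Prop := CourantIso {
  ci_unit : forall x, iota x \in unitmx;
  ci_smooth : smooth_hom E F iota;
  ci_inv_smooth : smooth_hom F E (fun x => invmx (iota x));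
  ci_h : forall x, (iota x)^T *m ca_h F x *m iota x = ca_h E x;
  ci_anchor : forall x, ca_anchor F x *m iota x = ca_anchor E x;
  ci_op : forall U e1 e2, open U -> smooth_sec E U e1 -> smooth_sec E U e2 ->
    eq_on U (happ iota (ca_op E e1 e2))
            (ca_op F (happ iota e1) (happ iota e2)) }.

Record generalized_metric (r : nat) (E : courant_algebroid r)
    (G : M -> 'M[R]_r) : Prop := GeneralizedMetric {
  gm_smooth : smooth_hom E E G;
  gm_invol : forall x, G x *m G x = 1%:M;
  gm_sym : forall x (u v : 'cV[R]_r),
    ((G x *m u)^T *m ca_h E x *m v) ord0 ord0 =
    (u^T *m ca_h E x *m (G x *m v)) ord0 ord0;
  gm_pos : forall x (u : 'cV[R]_r), u != 0 ->
    0 < ((G x *m u)^T *m ca_h E x *m u) ord0 ord0 }.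

Record E_connection (r q : nat) (E : courant_algebroid r) (F : framing q)
    (nab : sec r -> sec q -> sec q) : Prop := EConnection {
  ec_smooth : forall U e s, open U -> smooth_sec E U e -> smooth_sec F U s ->
    smooth_sec F U (nab e s);
  ec_local : forall U e e' s s', open U ->
    smooth_sec E U e -> smooth_sec E U e' ->
    smooth_sec F U s -> smooth_sec F U s' ->
    eq_on U e e' -> eq_on U s s' -> eq_on U (nab e s) (nab e' s');
  ec_addl : forall U e e' s, open U ->
    smooth_sec E U e -> smooth_sec E U e' -> smooth_sec F U s ->
    eq_on U (nab (sadd e e') s) (sadd (nab e s) (nab e' s));
  ec_scalel : forall U f e s, open U ->
    smooth_fun U f -> smooth_sec E U e -> smooth_sec F U s ->
    eq_on U (nab (sscale f e) s) (sscale f (nab e s));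
  ec_addr : forall U e s s', open U ->
    smooth_sec E U e -> smooth_sec F U s -> smooth_sec F U s' ->
    eq_on U (nab e (sadd s s')) (sadd (nab e s) (nab e s'));
  ec_leibniz : forall U f e s, open U ->
    smooth_fun U f -> smooth_sec E U e -> smooth_sec F U s ->
    eq_on U (nab e (sscale f s))
            (sadd (sscale (ca_act E e f) s) (sscale f (nab e s))) }.

(* The endomorphism e |-> nab_e v of E, at the point x: its matrix is read off
   from its values on a frame around x. *)
Definition cov_end (r : nat) (E : courant_algebroid r)
    (nab : sec r -> sec r -> sec r) (v : sec r) : M -> 'M[R]_r := fun x =>
  (\matrix_(k, j) nab (fun y => col j (bframe (bat E x) y)) v x k ord0)
    *m invmx (bframe (bat E x) x).

(* h(B u, v) = h(u, B^* v) *)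
Definition h_adjoint (r : nat) (E : courant_algebroid r) (B : M -> 'M[R]_r) :
    M -> 'M[R]_r := fun x => invmx (ca_h E x) *m (B x)^T *m ca_h E x.

Definition torsion (r : nat) (E : courant_algebroid r)
    (nab : sec r -> sec r -> sec r) (e1 e2 : sec r) : sec r := fun x =>
  nab e1 e2 x - nab e2 e1 x - ca_op E e1 e2 x
  + h_adjoint E (cov_end E nab e1) x *m e2 x.

Record generalized_LC (r : nat) (E : courant_algebroid r) (G : M -> 'M[R]_r)
    (nab : sec r -> sec r -> sec r) : Prop := GeneralizedLC {
  lc_conn : E_connection E E nab;
  lc_h : forall U e u v, open U ->
    smooth_sec E U e -> smooth_sec E U u -> smooth_sec E U v ->
    eq_on U (ca_act E e (ca_hval E u v))
            (fun x => ca_hval E (nab e u) v x + ca_hval E u (nab e v) x);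
  lc_G : forall U e u, open U -> smooth_sec E U e -> smooth_sec E U u ->
    eq_on U (nab e (happ G u)) (happ G (nab e u));
  lc_torsion : forall U e1 e2, open U ->
    smooth_sec E U e1 -> smooth_sec E U e2 ->
    eq_on U (torsion E nab e1 e2) (fun=> 0) }.

(* nab = nabA (x) id + id (x) nabL, stated on decomposable local sections. *)
Definition product_connection (r q : nat) (E : courant_algebroid r)
    (A : framing q) (nabA : sec r -> sec q -> sec q)
    (L : framing 1) (nabL : sec r -> sec 1 -> sec 1)
    (nab : sec r -> sec q -> sec q) : Prop :=
  E_connection E (line_tensor A L) nab /\
  forall U e a l, open U ->
    smooth_sec E U e -> smooth_sec A U a -> smooth_sec L U l ->
    eq_on U (nab e (stensor a l))
            (sadd (stensor (nabA e a) l) (stensor a (nabL e l))).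

(* Connection induced on the densities of weight s: if nab_e F = F omega(e) for
   a frame F, the density equal to 1 on F has derivative -s tr(omega(e)) times
   itself. *)
Definition density_connection (s : R) (r q : nat) (E : courant_algebroid r)
    (A : framing q) (nabA : sec r -> sec q -> sec q)
    (nabL : sec r -> sec 1 -> sec 1) : Prop :=
  E_connection E (density s A) nabL /\
  forall U (i : bI A) (e : sec r), open U -> U `<=` bdom i ->
    smooth_sec E U e ->
    let omega x := invmx (bframe i x) *m
      \matrix_(k, j) nabA e (fun y => col j (bframe i y)) x k ord0 in
    let mu x := col ord0 (bframe (i : bI (density s A)) x) in
    eq_on U (nabL e mu) (fun x => - (s * \tr (omega x)) *: mu x).

(* Lie derivative of a density of weight s, in the preferred chart at x:
   L_X (g |dx|^s) = (X g + s (div X) g) |dx|^s. *)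
Definition lie_density (s : R) (X : M -> 'cV[R]_n) (mu : sec 1) : sec 1 :=
  fun x =>
  let i := mat x in
  let std y := bframe (i : bI (density s tangent)) y ord0 ord0 in
  let g y := mu y ord0 ord0 / std y in
  let comp (k : 'I_n) y := (invmx (tangent_frame i y) *m X y) k ord0 in
  let div := \sum_(k < n)
    'D_(basis_vec k) (comp k \o cinv (mchart i)) (mchart i x) in
  ((vact X g x + s * div * g x) * std x)%:M.

Record geometric_data (r : nat) := GeometricData {
  gEB : courant_algebroid r;
  gEB_transitive : transitive_ca gEB;
  gGB : M -> 'M[R]_r;
  gGB_metric : generalized_metric gEB gGB;
  gEF : courant_algebroid r;
  giota : M -> 'M[R]_r;
  giota_iso : courant_iso gEB gEF giota;
  gGF : M -> 'M[R]_r;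
  gGFE : forall x, gGF x = giota x *m gGB x *m invmx (giota x);
  gGF_metric : generalized_metric gEF gGF;
  gnabB : sec r -> sec r -> sec r;
  gnabB_LC : generalized_LC gEB gGB gnabB }.

Section Data.
Context {r : nat} (D : geometric_data r).

Let iota_inv x := invmx (giota D x).

Definition nabF (X Z : sec r) : sec r :=
  happ (giota D) (gnabB D X (happ iota_inv Z)).

(* nab^B transported by iota in both arguments. *)
Definition nabER (e u : sec r) : sec r := nabF (happ iota_inv e) u.

(* (End(R^m), c) is the Clifford algebra of (R^r, h). *)
Definition is_clifford_algebra (m : nat) (h : 'M[R]_r)
    (c : 'cV[R]_r -> 'M[R]_m) : Prop :=
  forall (A : algType R) (f : {linear 'cV[R]_r -> A}),
    (forall u, f u * f u = ((u^T *m h *m u) ord0 ord0)%:A) ->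
    let ext (g : 'M[R]_m -> A) :=
      [/\ linear g, g 1%:M = 1, (forall P Q, g (P *m Q) = g P * g Q)
        & forall u, g (c u) = f u] in
    exists2 g, ext g & forall g', ext g' -> g' =1 g.

(* Endomorphisms act on the left of column vectors. The connections on
   |det S0^*|^(1/m), S, L and S (x) L are operators subject to the formulas that
   define them: these formulas determine the operators on local frames, hence
   everywhere by locality and the Leibniz rule. *)
Record spinor_data (m : nat) := SpinorData {
  sp_even : ~~ odd r;
  sp_S0 : vbundle m;
  sp_c : M -> 'cV[R]_r -> 'M[R]_m;
  sp_c_linear : forall x, linear (sp_c x);
  sp_c_square : forall x u,
    sp_c x u *m sp_c x u = ((u^T *m ca_h (gEF D) x *m u) ord0 ord0)%:M;
  sp_c_smooth : forall U e s, open U ->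
    smooth_sec (gEF D) U e -> smooth_sec sp_S0 U s ->
    smooth_sec sp_S0 U (fun x => sp_c x (e x) *m s x);
  sp_absirr : forall x (A : 'M[R]_m),
    (forall u, A *m sp_c x u = sp_c x u *m A) -> exists a : R, A = a%:M;
  sp_cliff : forall x, is_clifford_algebra (ca_h (gEF D) x) (sp_c x);

  sp_nab0 : sec r -> sec m -> sec m;
  sp_nab0_conn : E_connection (gEF D) sp_S0 sp_nab0;
  sp_nab0_lift : forall U e u s, open U ->
    smooth_sec (gEF D) U e -> smooth_sec (gEF D) U u -> smooth_sec sp_S0 U s ->
    eq_on U (sp_nab0 e (fun x => sp_c x (u x) *m s x))
            (fun x => sp_c x (nabER e u x) *m s x + sp_c x (u x) *m sp_nab0 e s x);

  sp_det := density m%:R^-1 sp_S0;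
  sp_SR := line_tensor sp_S0 sp_det;
  sp_nabdet : sec r -> sec 1 -> sec 1;
  sp_nabdetP : density_connection m%:R^-1 (gEF D) sp_S0 sp_nab0 sp_nabdet;
  sp_nabS : sec r -> sec m -> sec m;
  sp_nabSP : product_connection (gEF D) sp_S0 sp_nab0 sp_det sp_nabdet sp_nabS;

  sp_J : M -> 'M[R[i]]_m;
  sp_J_smooth : smooth_hom sp_SR sp_SR (fun x => map_mx (@complex.Re R) (sp_J x)) /\
                smooth_hom sp_SR sp_SR (fun x => map_mx (@complex.Im R) (sp_J x));
  sp_J_invol : forall x, sp_J x *m sp_J x = 1%:M;
  sp_J_anti : forall x u, let cu := map_mx (real_complex R) (sp_c x u) in
    sp_J x *m cu = - (cu *m sp_J x);

  sp_L := density 2^-1 tangent;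
  sp_nabL : sec r -> sec 1 -> sec 1;
  sp_nabL_conn : E_connection (gEF D) sp_L sp_nabL;
  sp_nabLE : forall U v mu, open U ->
    smooth_sec (gEF D) U v -> smooth_sec sp_L U mu ->
    eq_on U (sp_nabL v mu)
      (fun x => lie_density 2^-1 (happ (ca_anchor (gEF D)) v) mu x
                - (2^-1 * \tr (cov_end (gEF D) nabER v x)) *: mu x);

  sp_bundle := line_tensor sp_SR sp_L;
  sp_nab : sec r -> sec m -> sec m;
  sp_nabP : product_connection (gEF D) sp_SR sp_nabS sp_L sp_nabL sp_nab }.

Local Notation C := R[i].

Definition csec (q : nat) := M -> 'cV[C]_q.

Definition sre {q : nat} (s : csec q) : sec q := fun x => map_mx (@complex.Re R) (s x).
Definition sim {q : nat} (s : csec q) : sec q := fun x => map_mx (@complex.Im R) (s x).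
Definition smk {q : nat} (s t : sec q) : csec q :=
  fun x => map2_mx (@Complex R) (s x) (t x).

Definition csmooth_fun (U : set M) (f : M -> C) : Prop :=
  smooth_fun U (fun x => complex.Re (f x)) /\ smooth_fun U (fun x => complex.Im (f x)).

Definition csmooth_sec (q : nat) (F : framing q) (U : set M) (s : csec q) :
    Prop := smooth_sec F U (sre s) /\ smooth_sec F U (sim s).

(* C-bilinear extension of a real bilinear operation *)
Definition cplx_op {p q : nat} (op : sec p -> sec q -> sec q) (e : csec p)
    (s : csec q) : csec q :=
  smk (fun x => op (sre e) (sre s) x - op (sim e) (sim s) x)
      (fun x => op (sre e) (sim s) x + op (sim e) (sre s) x).

Definition cact (E : courant_algebroid r) (e : csec r) (f : M -> C) : M -> C :=
  let f1 x := complex.Re (f x) in let f2 x := complex.Im (f x) in fun x =>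
  Complex (ca_act E (sre e) f1 x - ca_act E (sim e) f2 x)
          (ca_act E (sre e) f2 x + ca_act E (sim e) f1 x).

(* Sections of E^{B,F} = E^B (+) E^F *)
Definition prB (Z : csec (r + r)) : csec r := fun x => usubmx (Z x).
Definition prF (Z : csec (r + r)) : csec r := fun x => dsubmx (Z x).

Definition csmooth_BF (U : set M) (Z : csec (r + r)) : Prop :=
  csmooth_sec (gEB D) U (prB Z) /\ csmooth_sec (gEF D) U (prF Z).

Definition nabBF (e : csec r) (Z : csec (r + r)) : csec (r + r) := fun x =>
  col_mx (cplx_op (gnabB D) e (prB Z) x) (cplx_op nabF e (prF Z) x).

(* The tensor algebra of C^(r+r): finite linear combinations of words in the
   basis, given by their coefficients. *)
Definition tens := seq 'I_(r + r) -> C.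
Definition tfield := M -> tens.

Definition tfun (f : M -> C) : tfield := fun x w =>
  if w is [::] then f x else 0.
Definition tvec (Z : csec (r + r)) : tfield := fun x w =>
  if w is [:: i] then Z x i ord0 else 0.
Definition tadd (t u : tfield) : tfield := fun x w => t x w + u x w.
Definition tscale (f : M -> C) (t : tfield) : tfield := fun x w => f x * t x w.
Definition tmul (t u : tfield) : tfield := fun x w =>
  \sum_(i < (size w).+1) t x (take i w) * u x (drop i w).
Definition tone : tfield := tfun (fun=> 1).
Definition tprod (Zs : seq (csec (r + r))) : tfield :=
  foldr (fun Z t => tmul (tvec Z) t) tone Zs.

Definition homog (k : nat) (U : set M) (t : tfield) : Prop :=
  forall x w, U x -> size w != k -> t x w = 0.

(* Coefficients of t in the tensor powers of the frame (i, j) of E^B (+) E^F. *)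
Definition tcoef (i : bI (gEB D)) (j : bI (gEF D)) (t : tfield) : tfield :=
  fun x w =>
  let P := map_mx (real_complex R)
    (invmx (block_mx (bframe i x) 0 0 (bframe j x))) in
  \sum_(u : (size w).-tuple 'I_(r + r))
    (\prod_(l < size w) P (tnth (in_tuple w) l) (tnth u l)) * t x u.

Definition smooth_tens (U : set M) (t : tfield) : Prop :=
  (exists d : nat, forall x w, U x -> (d < size w)%N -> t x w = 0) /\
  forall (i : bI (gEB D)) (j : bI (gEF D)) w,
    csmooth_fun (U `&` (bdom i `&` bdom j)) (fun x => tcoef i j t x w).

(* The connection induced from nab^B (+) nab^F by the Leibniz rule: it is
   determined by its values in degrees 0 and 1. *)
Record tensor_connection (nabT : csec r -> tfield -> tfield) : Prop :=
  TensorConnection {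
  tc_smooth : forall U e t, open U ->
    csmooth_sec (gEB D) U e -> smooth_tens U t -> smooth_tens U (nabT e t);
  tc_local : forall U e e' t t', open U ->
    csmooth_sec (gEB D) U e -> csmooth_sec (gEB D) U e' ->
    smooth_tens U t -> smooth_tens U t' ->
    eq_on U e e' -> eq_on U t t' -> eq_on U (nabT e t) (nabT e' t');
  tc_linearl : forall U f e e' t, open U -> csmooth_fun U f ->
    csmooth_sec (gEB D) U e -> csmooth_sec (gEB D) U e' -> smooth_tens U t ->
    eq_on U (nabT (fun x => f x *: e x + e' x) t)
            (tadd (tscale f (nabT e t)) (nabT e' t));
  tc_addr : forall U e t t', open U ->
    csmooth_sec (gEB D) U e -> smooth_tens U t -> smooth_tens U t' ->
    eq_on U (nabT e (tadd t t')) (tadd (nabT e t) (nabT e t'));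
  tc_fun : forall U e f, open U ->
    csmooth_sec (gEB D) U e -> csmooth_fun U f ->
    eq_on U (nabT e (tfun f)) (tfun (cact (gEB D) e f));
  tc_vec : forall U e Z, open U ->
    csmooth_sec (gEB D) U e -> csmooth_BF U Z ->
    eq_on U (nabT e (tvec Z)) (tvec (nabBF e Z));
  tc_leibniz : forall U e t u, open U ->
    csmooth_sec (gEB D) U e -> smooth_tens U t -> smooth_tens U u ->
    eq_on U (nabT e (tmul t u))
            (tadd (tmul (nabT e t) u) (tmul t (nabT e u))) }.

Definition parallel (nabT : csec r -> tfield -> tfield) (U : set M)
    (t : tfield) : Prop :=
  smooth_tens U t /\
  forall e, csmooth_sec (gEB D) U e -> eq_on U (nabT e t) (fun=> (fun=> 0)).

Section Action.
Context {m : nat} (Sp : spinor_data m).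

Definition nabSp (e : csec r) (s : csec m) : csec m :=
  cplx_op (fun e' s' => sp_nab Sp (happ (giota D) e') s') e s.

Definition cliff (u : csec r) (s : csec m) : csec m := fun x =>
  map2_mx (@Complex R) (sp_c Sp x (sre u x)) (sp_c Sp x (sim u x)) *m s x.

Definition csmooth_spinor (U : set M) (s : csec m) : Prop :=
  csmooth_sec (sp_bundle Sp) U s.

Definition A_op (Z : csec (r + r)) (s : csec m) : csec m := fun x =>
  nabSp (prB Z) s x + cliff (prF Z) s x.

Fixpoint A_iter (k : nat) (Zs : seq (csec (r + r))) (s : csec m) : csec m :=
  match k, Zs with
  | k'.+1, Z0 :: Zs' => fun x =>
      A_op Z0 (A_iter k' Zs' s) x
      - \sum_(j < size Zs')
          A_iter k' (set_nth Z0 Zs' j (nabBF (prB Z0) (nth Z0 Zs' j))) s x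
  | _, _ => s
  end.

(* (A^k s)(Z_1, ..., Z_k) *)
Definition A_pow (Zs : seq (csec (r + r))) (s : csec m) : csec m :=
  A_iter (size Zs) Zs s.

Definition all_smooth (U : set M) (Zs : seq (csec (r + r))) : Prop :=
  foldr (fun Z P => csmooth_BF U Z /\ P) True Zs.

Record tensor_action (U : set M) (Phi : tfield -> csec m -> csec m) : Prop :=
  TensorAction {
  ta_smooth : forall t s, smooth_tens U t -> csmooth_spinor U s ->
    csmooth_spinor U (Phi t s);
  ta_ext : forall t t' s s', smooth_tens U t -> smooth_tens U t' ->
    csmooth_spinor U s -> csmooth_spinor U s' ->
    eq_on U t t' -> eq_on U s s' -> eq_on U (Phi t s) (Phi t' s');
  ta_linear : forall f t t' s, csmooth_fun U f ->
    smooth_tens U t -> smooth_tens U t' -> csmooth_spinor U s ->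
    eq_on U (Phi (tadd (tscale f t) t') s)
            (fun x => f x *: Phi t s x + Phi t' s x);
  ta_fun : forall f s, csmooth_fun U f -> csmooth_spinor U s ->
    eq_on U (Phi (tfun f) s) (fun x => f x *: s x) }.

Definition is_Phi (U : set M) (Phi : tfield -> csec m -> csec m) : Prop :=
  tensor_action U Phi /\
  forall Zs s, all_smooth U Zs -> csmooth_spinor U s ->
    eq_on U (Phi (tprod Zs) s) (A_pow Zs s).

(* The product Y_1 (x) ... (x) Y_j of homogeneous tensor fields is a single
   homogeneous tensor field Y, and Y itself is such a product (j = 1). *)
Definition is_Phi' (nabT : csec r -> tfield -> tfield) (U : set M)
    (Phi' : tfield -> csec m -> csec m) : Prop :=
  [/\ tensor_action U Phi',
      forall Z s, csmooth_BF U Z -> csmooth_spinor U s ->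
        eq_on U (Phi' (tvec Z) s)
                (fun x => nabSp (prB Z) s x + cliff (prF Z) s x)
    & forall Z (k : nat) Y s, csmooth_BF U Z ->
        smooth_tens U Y -> homog k U Y -> csmooth_spinor U s ->
        eq_on U (Phi' (tmul (tvec Z) Y) s)
          (fun x => nabSp (prB Z) (Phi' Y s) x + cliff (prF Z) (Phi' Y s) x
                    - Phi' (nabT (prB Z) Y) s x)].

Record parallel_module (nabT : csec r -> tfield -> tfield) (U : set M)
    (Phi : tfield -> csec m -> csec m) : Prop := ParallelModule {
  pm_closed : forall a s, parallel nabT U a -> csmooth_spinor U s ->
    csmooth_spinor U (Phi a s);
  pm_one : forall s, csmooth_spinor U s -> eq_on U (Phi tone s) s;
  pm_mul : forall a b s, parallel nabT U a -> parallel nabT U b ->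
    csmooth_spinor U s -> eq_on U (Phi (tmul a b) s) (Phi a (Phi b s));
  pm_linearl : forall (z : C) a b s, parallel nabT U a -> parallel nabT U b ->
    csmooth_spinor U s ->
    eq_on U (Phi (tadd (tscale (fun=> z) a) b) s)
            (fun x => z *: Phi a s x + Phi b s x);
  pm_linearr : forall (z : C) a s s', parallel nabT U a ->
    csmooth_spinor U s -> csmooth_spinor U s' ->
    eq_on U (Phi a (fun x => z *: s x + s' x))
            (fun x => z *: Phi a s x + Phi a s' x) }.

End Action.
End Data.
End Geometry.

(* Main.v *)
(* [Phi] and [Phi'] are C^oo-linear in the tensor. Any [Phi'] unfolds on a product
   [Z1 (x) ... (x) Zk] of vector fields, by the Leibniz rule for [nabT], into the
   recursion that defines [A_pow], so it only remains to see that such products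
   determine an action. A tensor field decomposes into them through local
   frames; after multiplication by a power of a bump function equal to 1 at a
   given point the frame fields extend by zero to all of U, and C^oo-linearity
   gives the value at that point. For existence, recursion on the degree along a local
   frame defines an action over the domain of the frame: in
     t |-> A_Z (Phi t) - Phi (nabT_Z t)
   the derivative terms produced by [f *: t] cancel. By uniqueness these local
   actions do not depend on the frame, hence they glue. *)

Require Import Defs.
From mathcomp Require Import all_boot all_order all_algebra.
From mathcomp Require Import all_classical all_reals all_analysis.
From mathcomp Require Import complex.
From mathcomp Require Import ring lra.
Set Implicit Arguments.
Unset Strict Implicit.
Unset Printing Implicit Defensive.
Import Order.TTheory GRing.Theory Num.Theory numFieldNormedType.Exports.
Local Open Scope classical_set_scope.
Local Open Scope ring_scope.

(** * Smooth functions and cutoffs *)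

(** Neither definition gives a formula for an arbitrary tensor field: beyond degree zero, [is_Phi]
    prescribes values on products of vector fields smooth on all of [U], and [is_Phi'] on products
    with a first factor of this kind. Both are compared with a third notion, [recursive k U s Phi],
    for a fixed spinor [s] and tensors of degree at most [k]. The spinor enters it only as the value
    in degree zero, so that derived maps such as [a |-> Phi (tmul a b) s] can be tested against it.
    Degrees are bounded rather than fixed because smooth tensor fields mix degrees; [is_Phi'],
    stated for homogeneous tensors, is brought to this form by splitting off the top degree. Passing
    from [is_Phi'] to [is_Phi] is a computation on products. The converse is not: the recursion for
    a general [Y] is inherited from a constructed action, to which [Phi] is equal by uniqueness.
    Existence thus also enters the module structure of [Phi]. *)

Section Smooth_Euclidean.
Context {R : realType} {n : nat}.
Implicit Types (V : set 'cV[R]_n) (f g : 'cV[R]_n -> R).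

Lemma is_Ck_ext k V f g : open V -> (forall x, V x -> f x = g x) ->
  is_Ck k V f -> is_Ck k V g.
Proof.
move=> oV; elim: k f g => [|k IH] f g fg /=.
  move=> cf x Vx; have nfg : \near x, f x = g x.
    by apply: filterS (open_nbhs_nbhs (conj oV Vx)).
  rewrite /prop_for /continuous_at -fg//.
  by apply: cvg_trans (cf x Vx); exact: (@near_eq_cvg _ _ (nbhs x) _ f g nfg).
move=> [df ckf]; split.
  move=> x v Vx; apply: near_eq_derivable (df x v Vx).
  by apply: filterS (open_nbhs_nbhs (conj oV Vx)).
move=> v; apply: IH (ckf v) => x Vx; apply: near_eq_derive.
by apply: filterS (open_nbhs_nbhs (conj oV Vx)).
Qed.

(** ['D_v f] is the derivative of the total function, not one relative to [V], so the condition is a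
    conjunction over the points of [V]. Restricting and gluing smooth functions reduce to this. *)
Lemma is_CkP k V f : is_Ck k V f <-> forall x, V x -> is_Ck k [set x] f.
Proof.
elim: k f => [|k IH] f /=.
  by split => [H x Vx y ->|H x Vx]; [apply: H|apply: (H x Vx)].
split=> [[df ckf] x Vx|H]; split.
- by move=> y v ->; apply: df.
- by move=> v; exact: (IH _).1 (ckf v) x Vx.
- by move=> x v Vx; apply: (H x Vx).1.
- by move=> v; apply/(IH _).2 => x Vx; exact: (H x Vx).2 v.
Qed.

Lemma is_Ck_cst k V (c : R) : is_Ck k V (fun=> c).
Proof.
elim: k c => [|k IH] c /=; first by move=> x _; exact: cst_continuous.
split=> [x v _|v]; first exact: derivable_cst.
suff -> : (fun x : 'cV[R]_n => 'D_v (fun=> c) x) = (fun=> 0) by exact: IH.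
by apply/funext => x; exact: derive_cst.
Qed.

Lemma is_Ck_add k V f g : open V -> is_Ck k V f -> is_Ck k V g ->
  is_Ck k V (fun x => f x + g x).
Proof.
move=> oV; elim: k f g => [|k IH] f g /=.
  by move=> cf cg x Vx; apply: continuousD; [exact: cf|exact: cg].
move=> [df cf] [dg cg]; split=> [x v Vx|v].
  by apply: derivableD; [exact: df|exact: dg].
apply: is_Ck_ext (IH _ _ (cf v) (cg v)) => // x Vx.
by rewrite -[RHS]/('D_v (f + g) x) deriveD//; [exact: df|exact: dg].
Qed.

Lemma is_Cinfty_derive V f v : is_Cinfty V f -> is_Cinfty V ('D_v f).
Proof. by move=> cf k; exact: (cf k.+1).2. Qed.

(** The clauses of [is_Ck k.+1] do not list [is_Ck k], while the product rule leaves an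
    undifferentiated factor that must be of order [k]; assuming all orders up to [k] supplies it. *)
Lemma is_Ck_mul k V f g : open V ->
  (forall j, (j <= k)%N -> is_Ck j V f) -> (forall j, (j <= k)%N -> is_Ck j V g) ->
  is_Ck k V (fun x => f x * g x).
Proof.
move=> oV; elim: k f g => [|k IH] f g cf cg /=.
  by move=> x Vx; apply: continuousM; [exact: (cf 0)|exact: (cg 0)].
have df : forall x v, V x -> derivable f x v by exact: (cf 1 _).1.
have dg : forall x v, V x -> derivable g x v by exact: (cg 1 _).1.
split=> [x v Vx|v]; first by apply: derivableM; [exact: df|exact: dg].
have H (h h' : 'cV[R]_n -> R) : (forall j, (j <= k.+1)%N -> is_Ck j V h) ->
    (forall j, (j <= k.+1)%N -> is_Ck j V h') -> is_Ck k V (fun x => h x * 'D_v h' x).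
  move=> ch ch'; apply: IH => j jk; first by apply: ch; exact: leqW.
  exact: (ch' j.+1 _).2.
apply: is_Ck_ext (is_Ck_add oV (H _ _ cf cg) (H _ _ cg cf)) => // x Vx.
by rewrite -[RHS]/('D_v (f * g) x) deriveM//; [exact: df|exact: dg].
Qed.

End Smooth_Euclidean.

(** * The flat function exp(-1/t) and its derivatives *)

Section Flat_function.
Context {R : realType}.
Implicit Types (p : {poly R}) (t : R).

(** The polynomial factor makes the family of exp(-1/t) closed under differentiation, so one
    induction handles all orders. *)
Definition flat p t : R := if 0 < t then p.[t^-1] * expR (- t^-1) else 0.

(** The polynomial of the derivative: with u = 1/t, the chain rule contributes u^2 to both terms,
    with a minus sign on the one that differentiates [p]. *)
Definition flat_next p : {poly R} := 'X^2 * (p - p^`()).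

(** With u = 1/t, the term of degree i + 1 in the series of exp u gives u^(i+1) <= (i+1)! exp u. The
    power beyond i is what gains the factor t. *)
Lemma flatXn_bound i t : `|flat 'X^i t| <= (i.+1)`!%:R * `|t|.
Proof.
rewrite /flat; case: ifPn => t0; last by rewrite normr0 mulr_ge0.
have u0 : 0 < t^-1 by rewrite invr_gt0.
rewrite hornerXn expRN ger0_norm; last first.
  by rewrite mulr_ge0 ?exprn_ge0 ?invr_ge0 ?expR_ge0 ?ltW.
rewrite gtr0_norm// ler_pdivrMr ?expR_gt0//.
have h : t^-1 ^+ i.+1 / (i.+1)`!%:R <= expR t^-1.
  by apply: le_trans (expR_ge1Dxn i (ltW u0)); rewrite lerDr.
have f0 : 0 < (i.+1)`!%:R :> R by rewrite ltr0n fact_gt0.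
move: h; rewrite ler_pdivrMr// => h.
have -> : t^-1 ^+ i = t * t^-1 ^+ i.+1.
  by rewrite exprS mulrA divff ?mul1r ?gt_eqF.
rewrite (mulrC _ t) -mulrA ler_pM2l// mulrC.
by rewrite mulrC (mulrC _ (expR _)).
Qed.

Lemma flat_bound p : exists C : R, forall t, `|flat p t| <= C * `|t|.
Proof.
exists (\sum_(i < size p) `|p`_i| * (i.+1)`!%:R) => t.
have -> : flat p t = \sum_(i < size p) p`_i * flat 'X^i t.
  rewrite /flat; case: ifPn => t0; last by rewrite big1// => i _; rewrite mulr0.
  rewrite horner_coef mulr_suml; apply: eq_bigr => i _.
  by rewrite hornerXn mulrA.
apply: le_trans (ler_norm_sum _ _ _) _; rewrite mulr_suml.
apply: ler_sum => i _; rewrite normrM -mulrA ler_wpM2l//.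
exact: flatXn_bound.
Qed.

Lemma is_derive_flat p t : is_derive t 1 (flat p) (flat (flat_next p) t).
Proof.
have [t0|t0|<-] := ltgtP 0 t.
- have -> : flat (flat_next p) t =
    p.[t^-1] * (expR (- t^-1) * t ^- 2) + expR (- t^-1) * (p^`().[t^-1] * - t ^- 2).
    rewrite /flat t0 /flat_next !hornerE /= exprVn; ring.
  have nt : t != 0 by rewrite gt_eqF.
  pose g u := p.[u^-1] * expR (- u^-1).
  apply: (near_eq_is_derive (f := g)).
    near=> u; rewrite /flat /g ifT//; near: u; exact: lt_nbhsr.
  have dV : is_derive t 1 (fun u : R => u^-1) (- t ^- 2).
    have := @is_deriveV R id t 1 1 nt (is_derive_id _ _).
    by rewrite scaler1.
  have dp : is_derive t 1 (fun u : R => p.[u^-1]) (p^`().[t^-1] * - t ^- 2).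
    by apply: (@is_derive1_comp _ (horner p) (fun u => u^-1)).
  have de : is_derive t 1 (fun u : R => expR (- u^-1)) (expR (- t^-1) * t ^- 2).
    apply: (@is_derive1_comp _ expR (fun u => - u^-1)).
    by rewrite -[X in is_derive _ _ _ X]opprK; apply: is_deriveN.
  exact: is_deriveM.
- rewrite {2}/flat ltNge (ltW t0) /=.
  apply: (near_eq_is_derive (f := cst 0)).
  near=> u; rewrite /flat ltNge ltW//; near: u; exact: lt_nbhsl.
- rewrite {2}/flat ltxx.
  (* The difference quotient of [flat p] at 0 is [flat ('X * p)], again in the family and hence
     bounded by a multiple of |h|. *)
  have [C HC] := flat_bound ('X * p).
  suff H : (fun h : R => h^-1 *: (flat p (h *: 1 + 0) - flat p 0)) @ 0^' --> (0 : R).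
    by apply: DeriveDef; [apply/cvg_ex; exists 0|apply: cvg_lim].
  have E (h : R) : h^-1 *: (flat p (h *: 1 + 0) - flat p 0) = flat ('X * p) h.
    rewrite addr0 [h *: 1]mulr1 {2}/flat ltxx subr0 /flat.
    by case: ifP => _; rewrite ?scaler0// !hornerE /= [_ *: _]mulrA.
  under eq_fun do rewrite E.
  have L : (fun h : R => C * `|h|) @ 0^' --> (0 : R).
    have c0 : (fun h : R => C * `|h|) @ (nbhs (0:R)) --> C * `|0 : R|.
      by apply: cvgM; [exact: cvg_cst|exact: norm_continuous].
    by rewrite normr0 mulr0 in c0; exact: cvg_within_filter c0.
  have L' : (fun h : R => - (C * `|h|)) @ 0^' --> (0 : R).
    by have /(_ _) := cvgN L; rewrite oppr0; apply.
  by apply: (squeeze_cvgr _ L' L); near=> h; rewrite -ler_norml HC.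
Unshelve. all: by end_near. Qed.

Lemma is_Ck_flat k (n : nat) (V : set 'cV[R]_n) p f : open V ->
  is_Cinfty V f -> is_Ck k V (fun x => flat p (f x)).
Proof.
move=> oV cf.
(* Differentiation replaces [p] by [flat_next p], and [is_Ck_mul] asks for all lower orders; both
   [p] and the order are therefore generalised. *)
suff: forall j, (j <= k)%N -> forall p, is_Ck j V (fun x => flat p (f x)) by exact.
elim: k => [|k IH] j.
  rewrite leqn0 => /eqP -> {}p /=.
  move=> x Vx; apply: (@continuous_comp _ _ _ f (flat p)); first exact: (cf 0).
  apply: differentiable_continuous; apply/derivable1_diffP.
  exact: (@ex_derive _ _ _ _ _ _ _ (is_derive_flat _ _)).
rewrite leq_eqVlt => /predU1P[-> {}p|]; last exact: IH.
have D x v : V x -> is_derive x v (fun x => flat p (f x))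
                                  (flat (flat_next p) (f x) * 'D_v f x).
  move=> Vx; have dfx : derivable f x v by exact: (cf 1).1.
  (* A derivative along [v] is a derivative at 0 on the line through [x]. This reduces the chain
     rule to one variable, where derivability of [f] along [v] suffices. *)
  have line (h : 'cV[R]_n -> R) : 'D_1 (fun u : R => h (u *: v + x)) 0 = 'D_v h x.
    rewrite /derive; set g1 := fun h => h^-1 *: _; set g2 := fun h => h^-1 *: _.
    suff -> : g1 = g2 by [].
    by rewrite funeqE /g1 /g2 => u /=; rewrite addr0 scale0r add0r [_%:A]mulr1.
  suff [dF vF] : is_derive (0 : R) (1 : R) (fun u : R => flat p (f (u *: v + x)))
                             (flat (flat_next p) (f x) * 'D_v f x).
    by apply: DeriveDef; [exact/derivable1P|rewrite -line].
  have -> : f x = f (0 *: v + x) by rewrite scale0r add0r.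
  apply: (@is_derive1_comp R (flat p) (fun u : R => f (u *: v + x)) 0 _ _ (is_derive_flat _ _)).
  by apply: DeriveDef; [exact: (derivable1P f x v).1|exact: line].
split=> [x v Vx|v]; first exact: (@ex_derive _ _ _ _ _ _ _ (D x v Vx)).
have : is_Ck k V (fun x => flat (flat_next p) (f x) * 'D_v f x).
  apply: is_Ck_mul => // j' jk; [exact: IH|exact: is_Cinfty_derive].
by apply: is_Ck_ext => // x Vx; have [_ ->] := D x v Vx.
Qed.

End Flat_function.

(** Transposition will carry compact boxes of row vectors to boxes of coordinate columns. *)
Lemma trmx_continuous (T : topologicalType) (p q : nat) :
  continuous (@trmx T p q).
Proof.
move=> v A [P vP PA]; exists (fun i j => P j i) => [i j|w wP].
  by have := vP j i; rewrite mxE.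
by apply: PA => i j; rewrite mxE; exact: wP.
Qed.

(** * Smooth functions and bump functions on the manifold *)

Section Smooth_manifold.
Context {R : realType} {n : nat} {M : manifold R n}.
Implicit Types (U V W : set M) (f g : M -> R).

Lemma chart_image_open U (i : mI M) : open U ->
  open (mchart i @` (U `&` cdom (mchart i))).
Proof.
move=> oU; rewrite openE => _ [x [Ux ix] <-].
have imx : (mchart i @` cdom (mchart i)) (mchart i x) by exists x.
have cx : nbhs (mchart i x) (cinv (mchart i) @^-1` U).
  apply: (cinv_cont imx); rewrite (cfunK ix).
  exact: open_nbhs_nbhs.
have ix' : nbhs (mchart i x) (mchart i @` cdom (mchart i)).
  by apply: open_nbhs_nbhs; split => //; exact: cimg_open.
rewrite /interior; near=> y.
have [z iz zy] : (mchart i @` cdom (mchart i)) y by near: y.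
have : U (cinv (mchart i) y) by near: y.
by rewrite -zy (cfunK iz) => Uz; exists z.
Unshelve. all: by end_near. Qed.

Lemma smooth_funP U f : smooth_fun U f <-> forall x, U x -> smooth_fun [set x] f.
Proof.
split=> [sf x Ux i k|sf i k].
  apply/is_CkP => _ [_ [-> ix] <-].
  by apply: (is_CkP _ _ _).1 (sf i k) _ _; exists x.
apply/is_CkP => _ [x [Ux ix] <-].
by apply: (is_CkP _ _ _).1 (sf x Ux i k) _ _; exists x.
Qed.

Lemma smooth_fun_restrict U V f : V `<=` U -> smooth_fun U f -> smooth_fun V f.
Proof. by move=> VU /smooth_funP sf; apply/smooth_funP => x /VU; apply: sf. Qed.

Lemma smooth_fun_local U f :
  (forall x, U x -> exists2 V, V x & smooth_fun V f) -> smooth_fun U f.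
Proof.
move=> H; apply/smooth_funP => x /H[V Vx /smooth_funP]; exact.
Qed.

Lemma smooth_fun_ext U f g : open U -> eq_on U f g ->
  smooth_fun U f -> smooth_fun U g.
Proof.
move=> oU fg sf i k; apply: is_Ck_ext (sf i k); first exact: chart_image_open.
by move=> _ [x [Ux ix] <-]; rewrite /= (cfunK ix) fg.
Qed.

Lemma smooth_cst U (c : R) : smooth_fun U (fun=> c).
Proof. by move=> i k; exact: is_Ck_cst. Qed.

Lemma smooth_add U f g : open U -> smooth_fun U f -> smooth_fun U g ->
  smooth_fun U (fun x => f x + g x).
Proof.
move=> oU sf sg i k. exact: (is_Ck_add (chart_image_open oU (i := i)) (sf i k) (sg i k)).
Qed.

Lemma smooth_mul U f g : open U -> smooth_fun U f -> smooth_fun U g ->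
  smooth_fun U (fun x => f x * g x).
Proof.
move=> oU sf sg i k.
exact: (is_Ck_mul (chart_image_open oU (i := i)) (fun j _ => sf i j) (fun j _ => sg i j)).
Qed.

Lemma smooth_opp U f : open U -> smooth_fun U f -> smooth_fun U (fun x => - f x).
Proof.
move=> oU sf; have H := smooth_mul oU (smooth_cst U (-1)) sf.
apply: smooth_fun_ext H => //.
by move=> x _; rewrite mulN1r.
Qed.

Lemma smooth_sub U f g : open U -> smooth_fun U f -> smooth_fun U g ->
  smooth_fun U (fun x => f x - g x).
Proof. by move=> oU sf sg; apply: smooth_add => //; exact: smooth_opp. Qed.

Lemma smooth_sum (I : Type) (s : seq I) U (F : I -> M -> R) : open U ->
  (forall i, smooth_fun U (F i)) -> smooth_fun U (fun x => \sum_(i <- s) F i x).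
Proof.
move=> oU sF; elim: s => [|a s IH].
  by apply: smooth_fun_ext (smooth_cst _ 0) => // x _; rewrite big_nil.
apply: smooth_fun_ext (smooth_add oU (sF a) IH) => // x _.
by rewrite big_cons.
Qed.

Lemma smooth_flat U p f : open U -> smooth_fun U f ->
  smooth_fun U (fun x => flat p (f x)).
Proof.
move=> oU sf i k; exact: (is_Ck_flat k p (chart_image_open oU (i := i)) (sf i)).
Qed.

Lemma smooth_coord (i : mI M) (k : 'I_n) :
  smooth_fun (cdom (mchart i)) (fun x => mchart i x k ord0).
Proof. by move=> j; rewrite setIC; exact: mcompat. Qed.

(* The cutoff is a flat function of the squared coordinate distance to [x];
   compactness of a closed ball and the Hausdorff property make its support
   closed in [M], so that it extends by zero. *)
Lemma bump_function (V : set M) (x : M) : open V -> V x ->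
  exists chi : M -> R, exists W : set M,
  [/\ smooth_fun setT chi, chi x = 1, open W,
      forall y, V y \/ W y & forall y, W y -> chi y = 0].
Proof.
move=> oV Vx; set i := mat x; have ix : cdom (mchart i) x := matP x.
set a := mchart i x; set O := mchart i @` (V `&` cdom (mchart i)).
have oO : open O by exact: chart_image_open.
have /nbhs_ballP[e /= e0 eO] : nbhs a O.
  by apply: open_nbhs_nbhs; split => //; exists x.
set d := e / 2.
have d0 : 0 < d by apply: divr_gt0 => //; rewrite ltr0n.
pose K : set 'cV[R]_n := [set y | forall k, `|y k ord0 - a k ord0| <= d].
have KO : K `<=` O.
  move=> y Ky; apply: eO; split=> [|k j]; [exact: e0|rewrite [j]ord1 /=].
  rewrite -ball_normE /ball_ /= distrC; apply: le_lt_trans (Ky k) _.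
  by rewrite /d; lra.
have cK : compact K.
  pose A (k : 'I_n) : set R := `[a k ord0 - d, a k ord0 + d]%classic.
  have -> : K = trmx @` [set v : 'rV[R]_n | forall k, A k (v ord0 k)].
    apply/seteqP; split=> [y Ky|_ [v Av <-] k].
      exists y^T; last by rewrite trmxK.
      by move=> k; rewrite /A /= mxE in_itv/= -ler_distl.
    by have := Av k; rewrite /A /= in_itv /= -ler_distl mxE.
  apply: continuous_compact.
    apply: continuous_subspaceT => v; exact: trmx_continuous.
  by apply: rV_compact => k; exact: segment_compact.
pose C := cinv (mchart i) @` K.
have CV : C `<=` V `&` cdom (mchart i).
  by move=> _ [y /KO[z [Vz iz] <-] <-]; rewrite (cfunK iz).
have clC : closed C.
  apply: compact_closed; first exact: mtop_hausdorff.
  apply: continuous_compact => //.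
  apply: continuous_in_subspaceT => y /[!inE] /KO[z [_ iz] <-].
  by apply: cinv_cont; exists z.
(* A positive value bounds every coordinate difference by [d], so [flat 1 (g y)] vanishes outside
   the box [K]. *)
pose g y := d ^+ 2 - \sum_(k < n) (mchart i y k ord0 - a k ord0) ^+ 2.
pose chi y := if y \in cdom (mchart i)
  then flat 1 (g y) / flat 1 (d ^+ 2) else 0.
have chi0 y : (~` C) y -> chi y = 0.
  rewrite /chi; case: ifPn => // /[!inE] iy nCy.
  rewrite /flat ifF ?mul0r//; apply/negP => gy; apply: nCy.
  exists (mchart i y); last exact: cfunK.
  move=> k; have : (mchart i y k ord0 - a k ord0) ^+ 2 <= d ^+ 2.
    move: gy; rewrite /g subr_gt0 (bigD1 k)//= => /ltW; apply: le_trans.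
    by rewrite lerDl sumr_ge0// => ? _; exact: sqr_ge0.
  by rewrite ler_norml => h; apply/andP; split; nra.
have oW : open (~` C) by exact: closed_openC.
exists chi, (~` C); split => //.
- apply: smooth_fun_local => y _; have [iy|niy] := pselect (cdom (mchart i) y).
    exists (cdom (mchart i)) => //.
    have oi := cdom_open (mchart i).
    have sg : smooth_fun (cdom (mchart i)) g.
      apply: smooth_sub => //; first exact: smooth_cst.
      apply: smooth_sum => // k; apply: smooth_mul => //;
        by apply: smooth_sub => //; [exact: smooth_coord|exact: smooth_cst].
    apply: smooth_fun_ext (smooth_mul oi (smooth_flat 1 oi sg)
      (smooth_cst _ (flat 1 (d ^+ 2))^-1)) => //.
    by move=> z iz; rewrite /chi mem_set.
  exists (~` C); first by move=> /CV[].
  by apply: smooth_fun_ext (smooth_cst _ 0) => // z Cz; rewrite chi0.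
- rewrite /chi mem_set//.
  have -> : g x = d ^+ 2.
    by rewrite /g big1 ?subr0// => k _; rewrite subrr expr0n.
  by rewrite divff// /flat exprn_gt0// hornerC mul1r gt_eqF// expR_gt0.
- move=> y; have [/CV[]|] := pselect (C y); [by left|by right].
Qed.

End Smooth_manifold.

(** * Sections and complexified connections *)

Section Complex_smooth_functions.
Context {R : realType} {n : nat} {M : manifold R n}.
Implicit Types (U V W : set M) (f g : M -> R[i]).

Lemma complex_eq (a b : R[i]) :
  complex.Re a = complex.Re b -> complex.Im a = complex.Im b -> a = b.
Proof. by case: a b => [? ?] [? ?] /= -> ->. Qed.

Lemma csmooth_fun_restrict U V f : V `<=` U -> csmooth_fun U f -> csmooth_fun V f.
Proof. by move=> VU [s1 s2]; split; apply: smooth_fun_restrict VU _. Qed.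

Lemma csmooth_fun_local U f :
  (forall x, U x -> exists2 V, V x & csmooth_fun V f) -> csmooth_fun U f.
Proof.
by move=> H; split; apply: smooth_fun_local => x /H[V Vx []]; exists V.
Qed.

Lemma csmooth_fun_ext U f g : open U -> eq_on U f g ->
  csmooth_fun U f -> csmooth_fun U g.
Proof.
by move=> oU fg [s1 s2]; split; [move: s1|move: s2]; apply: smooth_fun_ext => //
  x Ux; rewrite fg.
Qed.

Lemma csmooth_real U (h : M -> R) : smooth_fun U h ->
  csmooth_fun U (fun x => real_complex R (h x)).
Proof. by move=> sh; split=> //; exact: smooth_cst. Qed.

Lemma csmooth_cst U (c : R[i]) : csmooth_fun U (fun=> c).
Proof. by split; exact: smooth_cst. Qed.

Lemma csmooth_add U f g : open U -> csmooth_fun U f -> csmooth_fun U g ->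
  csmooth_fun U (fun x => f x + g x).
Proof.
move=> oU [f1 f2] [g1 g2]; split.
  by apply: smooth_fun_ext (smooth_add oU f1 g1) => // x _; case: (f x) (g x) => [? ?] [].
by apply: smooth_fun_ext (smooth_add oU f2 g2) => // x _; case: (f x) (g x) => [? ?] [].
Qed.

Lemma csmooth_mul U f g : open U -> csmooth_fun U f -> csmooth_fun U g ->
  csmooth_fun U (fun x => f x * g x).
Proof.
move=> oU [f1 f2] [g1 g2]; split.
  have H := smooth_sub oU (smooth_mul oU f1 g1) (smooth_mul oU f2 g2).
  by apply: smooth_fun_ext H => // x _; case: (f x) (g x) => [? ?] [].
have H := smooth_add oU (smooth_mul oU f1 g2) (smooth_mul oU f2 g1).
by apply: smooth_fun_ext H => // x _; case: (f x) (g x) => [? ?] [].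
Qed.

Lemma csmooth_sum (I : Type) (s : seq I) U (F : I -> M -> R[i]) : open U ->
  (forall i, csmooth_fun U (F i)) -> csmooth_fun U (fun x => \sum_(i <- s) F i x).
Proof.
move=> oU sF; elim: s => [|a s IH].
  by apply: csmooth_fun_ext (csmooth_cst _ 0) => // x _; rewrite big_nil.
apply: csmooth_fun_ext (csmooth_add oU (sF a) IH) => // x _.
by rewrite big_cons.
Qed.

(** The open set [W], which covers together with [V] and on which [chi] vanishes, expresses that the
    closed support of [chi] lies in [V]. The product is smooth on each of the two open sets. *)
Lemma csmooth_cutoff U V W (chi f : M -> R[i]) : open U -> open V -> open W ->
  csmooth_fun U chi -> (forall y, V y \/ W y) -> (forall y, W y -> chi y = 0) ->
  csmooth_fun (U `&` V) f -> csmooth_fun U (fun x => chi x * f x).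
Proof.
move=> oU oV oW sc VW cW sf; apply: csmooth_fun_local => x Ux.
have [Vx|Wx] := VW x.
  exists (U `&` V) => //; apply: csmooth_mul => //; first exact: openI.
  by apply: csmooth_fun_restrict sc => ? [].
exists W => //; apply: csmooth_fun_ext (csmooth_cst _ 0) => // y Wy.
by rewrite cW// mul0r.
Qed.

End Complex_smooth_functions.

Section Sections.
Context {R : realType} {n : nat} {M : manifold R n}.
Implicit Types (U V W : set M).
Local Notation C := R[i].
Local Notation RC := (real_complex R).

Lemma smooth_sec_lin q (F : framing q) U (f : M -> R) (s t : sec q) :
  (forall i, open (bdom (f := F) i)) -> open U ->
  smooth_fun U f -> smooth_sec F U s -> smooth_sec F U t ->
  smooth_sec F U (fun x => f x *: s x + t x).
Proof.
move=> oF oU sf ss st i k; have oUi := openI oU (oF i).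
have H : smooth_fun (U `&` bdom i) f by apply: smooth_fun_restrict sf => ? [].
apply: smooth_fun_ext (smooth_add oUi (smooth_mul oUi H (ss i k)) (st i k)) => //.
by move=> x _; rewrite mulmxDr -scalemxAr !mxE.
Qed.

Lemma smooth_sec_restrict q (F : framing q) U V (s : sec q) :
  V `<=` U -> smooth_sec F U s -> smooth_sec F V s.
Proof.
by move=> VU ss i k; apply: smooth_fun_restrict (ss i k) => x [/VU].
Qed.

Definition ccoord q (F : framing q) (i : bI F) (s : csec q) (x : M) : 'cV[C]_q :=
  map_mx RC (invmx (bframe i x)) *m s x.

Lemma ccoordE q (F : framing q) (i : bI F) (s : csec q) x k :
  ccoord i s x k ord0 =
  Complex ((invmx (bframe i x) *m sre s x) k ord0) ((invmx (bframe i x) *m sim s x) k ord0).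
Proof.
rewrite /ccoord !mxE.
apply: complex_eq; rewrite /= raddf_sum; apply: eq_bigr => j _;
  by rewrite !mxE; case: (s x j ord0) => a b /=; ring.
Qed.

Lemma csmooth_secP q (F : framing q) U (s : csec q) : csmooth_sec F U s <->
  forall (i : bI F) k, csmooth_fun (U `&` bdom i) (fun x => ccoord i s x k ord0).
Proof.
split=> [[s1 s2] i k|H].
  by split; under eq_fun do rewrite ccoordE /=; [exact: s1|exact: s2].
by split=> i k; have [] := H i k; (under eq_fun do rewrite ccoordE /=);
  (under [in X in _ -> X -> _]eq_fun do rewrite ccoordE /=).
Qed.

Section Framing.
Context {q : nat} (F : framing (M := M) q) (oF : forall i : bI F, open (bdom i)).

Lemma csmooth_sec_lin U f (s t : csec q) : open U -> csmooth_fun U f ->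
  csmooth_sec F U s -> csmooth_sec F U t ->
  csmooth_sec F U (fun x => f x *: s x + t x).
Proof.
move=> oU sf /csmooth_secP ss /csmooth_secP st; apply/csmooth_secP => i k.
have oUi := openI oU (oF i).
have H : csmooth_fun (U `&` bdom i) f by apply: csmooth_fun_restrict sf => ? [].
apply: csmooth_fun_ext (csmooth_add oUi (csmooth_mul oUi H (ss i k)) (st i k)) => //.
by move=> x _; rewrite /ccoord mulmxDr -scalemxAr !mxE.
Qed.

Lemma csmooth_sec0 U : csmooth_sec F U (fun=> 0).
Proof.
apply/csmooth_secP => i k; under eq_fun do rewrite /ccoord mulmx0 mxE.
exact: csmooth_cst.
Qed.

Lemma csmooth_sec_add U (s t : csec q) : open U ->
  csmooth_sec F U s -> csmooth_sec F U t -> csmooth_sec F U (fun x => s x + t x).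
Proof.
move=> oU ss st; have := csmooth_sec_lin oU (csmooth_cst U 1) ss st.
by under eq_fun do rewrite scale1r.
Qed.

Lemma csmooth_sec_scale U f (s : csec q) : open U -> csmooth_fun U f ->
  csmooth_sec F U s -> csmooth_sec F U (fun x => f x *: s x).
Proof.
move=> oU sf ss; have := csmooth_sec_lin oU sf ss (csmooth_sec0 U).
by under eq_fun do rewrite addr0.
Qed.

Lemma csmooth_sec_opp U (s : csec q) : open U ->
  csmooth_sec F U s -> csmooth_sec F U (fun x => - s x).
Proof.
move=> oU ss; have := csmooth_sec_scale oU (csmooth_cst U (-1)) ss.
by under eq_fun do rewrite scaleN1r.
Qed.

Lemma csmooth_sec_sum (I : Type) (r : seq I) U (s : I -> csec q) : open U ->
  (forall i, csmooth_sec F U (s i)) -> csmooth_sec F U (fun x => \sum_(i <- r) s i x).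
Proof.
move=> oU ss; elim: r => [|a r IH].
  by under eq_fun do rewrite big_nil; exact: csmooth_sec0.
by under eq_fun do rewrite big_cons; exact: csmooth_sec_add.
Qed.

Lemma csmooth_sec_restrict U V (s : csec q) :
  V `<=` U -> csmooth_sec F U s -> csmooth_sec F V s.
Proof. by move=> VU [s1 s2]; split; apply: smooth_sec_restrict VU _. Qed.

Lemma csmooth_sec_ext U (s t : csec q) : open U -> eq_on U s t ->
  csmooth_sec F U s -> csmooth_sec F U t.
Proof.
move=> oU st /csmooth_secP ss; apply/csmooth_secP => i k.
apply: csmooth_fun_ext (ss i k); first exact: openI.
by move=> x [Ux _]; rewrite /ccoord st.
Qed.

Lemma csmooth_sec_local U (s : csec q) :
  (forall x, U x -> exists2 V, V x & csmooth_sec F V s) -> csmooth_sec F U s.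
Proof.
move=> H; apply/csmooth_secP => i k; apply: csmooth_fun_local => x [Ux ix].
by have [V Vx /csmooth_secP ss] := H x Ux; exists (V `&` bdom i).
Qed.

Lemma csmooth_sec_cutoff U V W chi (s : csec q) : open U -> open V -> open W ->
  csmooth_fun U chi -> (forall y, V y \/ W y) -> (forall y, W y -> chi y = 0) ->
  csmooth_sec F (U `&` V) s -> csmooth_sec F U (fun x => chi x *: s x).
Proof.
move=> oU oV oW sc VW cW /csmooth_secP ss; apply/csmooth_secP => i k.
under eq_fun do rewrite /ccoord -scalemxAr mxE.
apply: (csmooth_cutoff (V := V) (W := W)) => //; first exact: openI.
  by apply: csmooth_fun_restrict sc => ? [].
by rewrite setIAC; exact: ss.
Qed.

End Framing.

Definition frame_sec q (F : framing (M := M) q) (i : bI F) (l : 'I_q) : csec q :=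
  fun x => map_mx RC (col l (bframe i x)).

Lemma frame_sec_smooth q (F : vbundle (M := M) q) (i : bI F) l :
  csmooth_sec F (bdom i) (frame_sec i l).
Proof.
apply/csmooth_secP => j k; rewrite setIC.
have -> : (fun x => ccoord j (frame_sec i l) x k ord0) =
    (fun x => RC ((invmx (bframe j x) *m bframe i x) k l)).
  apply/funext => x; rewrite /ccoord /frame_sec -map_mxM !mxE; congr RC.
  by apply: eq_bigr => u _; rewrite mxE.
exact/csmooth_real/btrans.
Qed.

Section Complexified_operation.
Context {p q : nat} (E : framing (M := M) p) (F : framing (M := M) q).
Hypotheses (oE : forall i : bI E, open (bdom i)) (oF : forall i : bI F, open (bdom i)).
Variable op : @sec R n M p -> @sec R n M q -> @sec R n M q.

Lemma cplx_op_smooth U e s : open U ->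
  (forall e s, smooth_sec E U e -> smooth_sec F U s -> smooth_sec F U (op e s)) ->
  csmooth_sec E U e -> csmooth_sec F U s -> csmooth_sec F U (cplx_op op e s).
Proof.
move=> oU sop [e1 e2] [s1 s2]; split.
- have -> : sre (cplx_op op e s) =
      fun x => -1 *: op (sim e) (sim s) x + op (sre e) (sre s) x.
    by apply/funext => x; apply/matrixP=> i j; rewrite !mxE /=; ring.
  by apply: smooth_sec_lin => //; [exact: smooth_cst|exact: sop|exact: sop].
- have -> : sim (cplx_op op e s) =
      fun x => 1 *: op (sim e) (sre s) x + op (sre e) (sim s) x.
    by apply/funext => x; apply/matrixP=> i j; rewrite !mxE /=; ring.
  by apply: smooth_sec_lin => //; [exact: smooth_cst|exact: sop|exact: sop].
Qed.

End Complexified_operation.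

Section Complexified_connection.
Context {r q : nat} (E : courant_algebroid (M := M) r) (F : framing (M := M) q).
Context (nab : @sec R n M r -> @sec R n M q -> @sec R n M q).
Hypothesis oF : forall i : bI F, open (bdom i).
Hypothesis H : E_connection E F nab.

Let oE : forall i : bI E, open (bdom i) := @bdom_open _ _ _ _ (ca_bundle E).

Lemma smooth_sscale k (G : framing (M := M) k) U f (s : sec k) :
  (forall i : bI G, open (bdom i)) -> open U ->
  smooth_fun U f -> smooth_sec G U s -> smooth_sec G U (sscale f s).
Proof.
move=> oG oU sf ss i l; have oUi := openI oU (oG i).
have H' : smooth_fun (U `&` bdom i) f by apply: smooth_fun_restrict sf => ? [].
apply: smooth_fun_ext (smooth_mul oUi H' (ss i l)) => //.
by move=> x _; rewrite /sscale -scalemxAr [RHS]mxE.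
Qed.

Lemma smooth_sadd k (G : framing (M := M) k) U (s t : sec k) :
  (forall i : bI G, open (bdom i)) -> open U ->
  smooth_sec G U s -> smooth_sec G U t -> smooth_sec G U (sadd s t).
Proof.
move=> oG oU ss st; have := smooth_sec_lin oG oU (smooth_cst U 1) ss st.
by under eq_fun do rewrite scale1r.
Qed.

Lemma ca_act_cst e (c : R) : ca_act E e (fun=> c) = fun=> 0.
Proof. by apply/funext => x; rewrite /ca_act /vact; exact: derive_cst. Qed.

Lemma cplx_nab_local U e e' s s' : open U ->
  csmooth_sec E U e -> csmooth_sec E U e' -> csmooth_sec F U s -> csmooth_sec F U s' ->
  eq_on U e e' -> eq_on U s s' -> eq_on U (cplx_op nab e s) (cplx_op nab e' s').
Proof.
move=> oU [e1 e2] [e1' e2'] [s1 s2] [s1' s2'] ee ss x Ux.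
have ee1 : eq_on U (sre e) (sre e') by move=> y Uy; rewrite /sre ee.
have ee2 : eq_on U (sim e) (sim e') by move=> y Uy; rewrite /sim ee.
have ss1 : eq_on U (sre s) (sre s') by move=> y Uy; rewrite /sre ss.
have ss2 : eq_on U (sim s) (sim s') by move=> y Uy; rewrite /sim ss.
rewrite /cplx_op /smk.
rewrite (ec_local H oU e1 e1' s1 s1' ee1 ss1 Ux) (ec_local H oU e1 e1' s2 s2' ee1 ss2 Ux).
by rewrite (ec_local H oU e2 e2' s1 s1' ee2 ss1 Ux) (ec_local H oU e2 e2' s2 s2' ee2 ss2 Ux).
Qed.

Lemma nab_linl U f g a b c s : open U -> smooth_fun U f -> smooth_fun U g ->
  smooth_sec E U a -> smooth_sec E U b -> smooth_sec E U c -> smooth_sec F U s ->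
  eq_on U (nab (sadd (sscale f a) (sadd (sscale g b) c)) s)
     (fun x => f x *: nab a s x + (g x *: nab b s x + nab c s x)).
Proof.
move=> oU sf sg sa sb sc ss x Ux.
have h1 := smooth_sscale oE oU sf sa; have h2 := smooth_sscale oE oU sg sb.
have h3 := smooth_sadd oE oU h2 sc.
rewrite (ec_addl H oU h1 h3 ss Ux) /sadd (ec_addl H oU h2 sc ss Ux) /sadd.
by rewrite (ec_scalel H oU sf sa ss Ux) (ec_scalel H oU sg sb ss Ux).
Qed.

Lemma nab_linr U e f g a b c : open U -> smooth_fun U f -> smooth_fun U g ->
  smooth_sec E U e -> smooth_sec F U a -> smooth_sec F U b -> smooth_sec F U c ->
  eq_on U (nab e (sadd (sscale f a) (sadd (sscale g b) c)))
     (fun x => ca_act E e f x *: a x + f x *: nab e a x +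
        ((ca_act E e g x *: b x + g x *: nab e b x) + nab e c x)).
Proof.
move=> oU sf sg se sa sb sc x Ux.
have h1 := smooth_sscale oF oU sf sa; have h2 := smooth_sscale oF oU sg sb.
have h3 := smooth_sadd oF oU h2 sc.
rewrite (ec_addr H oU se h1 h3 Ux) /sadd (ec_addr H oU se h2 sc Ux) /sadd.
by rewrite (ec_leibniz H oU sf se sa Ux) (ec_leibniz H oU sg se sb Ux).
Qed.

Lemma nab_opp U e s : open U -> smooth_sec E U e -> smooth_sec F U s ->
  eq_on U (nab e (sscale (fun=> -1) s)) (fun x => - nab e s x).
Proof.
move=> oU se ss x Ux; rewrite (ec_leibniz H oU (smooth_cst U (-1)) se ss Ux).
by rewrite /sadd /sscale ca_act_cst scale0r add0r scaleN1r.
Qed.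

Lemma nab_oppl U e s : open U -> smooth_sec E U e -> smooth_sec F U s ->
  eq_on U (nab (sscale (fun=> -1) e) s) (fun x => - nab e s x).
Proof.
move=> oU se ss x Ux; rewrite (ec_scalel H oU (smooth_cst U (-1)) se ss Ux).
by rewrite /sscale scaleN1r.
Qed.

(** The sign coming from i^2 is written as a scaling by the constant function -1, so that the right
    side is built only from the sums and scalings in the axioms of a connection. *)
Lemma sre_lin k (f : M -> C) (s t : csec k) :
  sre (fun x => f x *: s x + t x) =
  sadd (sscale (fun x => complex.Re (f x)) (sre s))
    (sadd (sscale (fun x => complex.Im (f x)) (sscale (fun=> -1) (sim s))) (sre t)).
Proof.
apply/funext => x; apply/matrixP => i j; rewrite /sadd /sscale !mxE.
by case: (f x) (s x i j) (t x i j) => [? ?] [? ?] [? ?] /=; ring.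
Qed.

Lemma sim_lin k (f : M -> C) (s t : csec k) :
  sim (fun x => f x *: s x + t x) =
  sadd (sscale (fun x => complex.Re (f x)) (sim s))
    (sadd (sscale (fun x => complex.Im (f x)) (sre s)) (sim t)).
Proof.
apply/funext => x; apply/matrixP => i j; rewrite /sadd /sscale !mxE.
by case: (f x) (s x i j) (t x i j) => [? ?] [? ?] [? ?] /=; ring.
Qed.

Lemma cplx_nab_linl U f e e' s : open U -> csmooth_fun U f ->
  csmooth_sec E U e -> csmooth_sec E U e' -> csmooth_sec F U s ->
  eq_on U (cplx_op nab (fun x => f x *: e x + e' x) s)
     (fun x => f x *: cplx_op nab e s x + cplx_op nab e' s x).
Proof.
move=> oU [f1 f2] [e1 e2] [e1' e2'] [s1 s2] x Ux.
have e3 := smooth_sscale oE oU (smooth_cst U (-1)) e2.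
rewrite {1}/cplx_op /smk sre_lin sim_lin.
rewrite (nab_linl oU f1 f2 e1 e3 e1' s1 Ux) (nab_linl oU f1 f2 e1 e3 e1' s2 Ux).
rewrite (nab_linl oU f1 f2 e2 e1 e2' s1 Ux) (nab_linl oU f1 f2 e2 e1 e2' s2 Ux).
rewrite !(nab_oppl oU e2 _ Ux)// /cplx_op /smk.
apply/matrixP => i j; rewrite !mxE; case: (f x) => a b /=.
by apply: complex_eq => /=; ring.
Qed.

Lemma cplx_nab_leibniz U e f s t : open U -> csmooth_fun U f ->
  csmooth_sec E U e -> csmooth_sec F U s -> csmooth_sec F U t ->
  eq_on U (cplx_op nab e (fun x => f x *: s x + t x))
     (fun x => cact E e f x *: s x + f x *: cplx_op nab e s x + cplx_op nab e t x).
Proof.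
move=> oU [f1 f2] [e1 e2] [s1 s2] [t1 t2] x Ux.
have s3 := smooth_sscale oF oU (smooth_cst U (-1)) s2.
rewrite {1}/cplx_op /smk sre_lin sim_lin.
rewrite (nab_linr oU f1 f2 e1 s1 s3 t1 Ux) (nab_linr oU f1 f2 e2 s1 s3 t1 Ux).
rewrite (nab_linr oU f1 f2 e1 s2 s1 t2 Ux) (nab_linr oU f1 f2 e2 s2 s1 t2 Ux).
rewrite (nab_opp oU e1 s2 Ux) (nab_opp oU e2 s2 Ux) /cplx_op /smk /cact.
apply/matrixP => i j; rewrite /sscale !mxE.
case: (f x) (s x i j) => [a b] [c d] /=.
by apply: complex_eq => /=; ring.
Qed.

Lemma cact_cst e (c : C) : cact E e (fun=> c) = fun=> 0.
Proof.
by apply/funext => x; rewrite /cact !ca_act_cst; apply: complex_eq => /=; ring.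
Qed.

End Complexified_connection.
End Sections.

Section Bundle_maps.
Context {R : realType} {n : nat} {M : manifold R n}.

Lemma smooth_happ p q (E : vbundle (M := M) p) (F : vbundle (M := M) q) T U s :
  open U -> smooth_hom E F T -> smooth_sec E U s -> smooth_sec F U (happ T s).
Proof.
move=> oU sT ss j k; apply: smooth_fun_local => x [Ux jx].
pose i := bat E x; have ix : bdom i x := batP E x.
exists (U `&` (bdom i `&` bdom j)) => //.
have oV : open (U `&` (bdom i `&` bdom j)).
  by apply: openI => //; apply: openI; exact: bdom_open.
have H l : smooth_fun (U `&` (bdom i `&` bdom j)) (fun x =>
    (invmx (bframe j x) *m T x *m bframe i x) k l * (invmx (bframe i x) *m s x) l ord0).
  apply: smooth_mul => //; first by apply: smooth_fun_restrict (sT i j k l) => ? [].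
  by apply: smooth_fun_restrict (ss i l) => ? [? []].
apply: smooth_fun_ext (smooth_sum (index_enum _) oV H) => // y [_ [iy _]].
rewrite /happ; transitivity
  ((invmx (bframe j y) *m T y *m bframe i y *m (invmx (bframe i y) *m s y)) k ord0).
  by rewrite [RHS]mxE.
by rewrite -!mulmxA (mulKVmx (bframe_unit iy)).
Qed.

End Bundle_maps.

(** At a = 0 both sides vanish: [invmx] returns a singular matrix unchanged and the inverse of 0 is
    0. This covers the scalar factors in the frames of a tensor product with a line bundle. *)
Lemma invmx_scale (K : fieldType) m (a : K) (B : 'M[K]_m) : B \in unitmx ->
  invmx (a *: B) = a^-1 *: invmx B.
Proof.
move=> uB; have [->|a0] := eqVneq a 0.
  rewrite !scale0r invr0 scale0r; case: m B uB => [|m] B uB.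
    by rewrite flatmx0 [RHS]flatmx0.
  by rewrite /invmx unitmxE det0 unitr0.
by rewrite invmxZ// unitmxZ// unitfE.
Qed.

(** * Clifford multiplication and the connection on spinors *)

Section Operators.
Context {R : realType} {n r m : nat} {M : manifold R n}.
Context (D : geometric_data (M := M) r) (Sp : spinor_data D m).
Local Notation C := R[i].
Local Notation B := (sp_bundle Sp).

Lemma sp_open (i : bI B) : open (bdom i).
Proof.
by case: i => -[i0 i1] i2; apply: openI; [apply: openI|]; exact: bdom_open || exact: cdom_open.
Qed.

Lemma EB_open (i : bI (gEB D)) : open (bdom i). Proof. exact: (@bdom_open _ _ _ _ (gEB D)). Qed.
Lemma EF_open (i : bI (gEF D)) : open (bdom i). Proof. exact: (@bdom_open _ _ _ _ (gEF D)). Qed.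

(** Smoothness of Clifford multiplication is given on [sp_S0], whereas the spinor bundle is twisted
    by two density lines. Its frames are scalar multiples of frames of [sp_S0], and [sp_c] commutes
    with scalars; so it suffices to act on the section [t] of [sp_S0] with the same coordinates. *)
Lemma sp_c_bundle_smooth U e s : open U -> smooth_sec (gEF D) U e ->
  smooth_sec B U s -> smooth_sec B U (fun x => sp_c Sp x (e x) *m s x).
Proof.
move=> oU se ss [[i0 i1] i2] k; set i := ((i0, i1), i2) : bI B.
set W := U `&` bdom i.
have oW : open W by apply: openI => //; exact: sp_open.
have iW x : W x -> bdom i0 x by move=> [_ [[]]].
pose lam x := bframe i2 x ord0 ord0 * bframe i1 x ord0 ord0.
have framei x : bframe i x = lam x *: bframe i0 x by rewrite /= scalerA.
pose t x := bframe i0 x *m (invmx (bframe i x) *m s x).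
have st : smooth_sec (sp_S0 Sp) W t.
  move=> j l; have oWj : open (W `&` bdom j) by apply: openI => //; exact: bdom_open.
  have H a : smooth_fun (W `&` bdom j) (fun x =>
      (invmx (bframe j x) *m bframe i0 x) l a * (invmx (bframe i x) *m s x) a ord0).
    apply: smooth_mul => //; last by apply: smooth_fun_restrict (ss i a) => ? [].
    by apply: smooth_fun_restrict (btrans j i0 l a) => y [/iW].
  apply: smooth_fun_ext (smooth_sum (index_enum _) oWj H) => // y _.
  by rewrite /t mulmxA [RHS]mxE.
have seW : smooth_sec (gEF D) W e by apply: smooth_sec_restrict se => ? [].
have H := sp_c_smooth oW seW st i0 k.
apply: smooth_fun_ext (smooth_fun_restrict _ H) => //;
  last by move=> y Wy; split => //; exact: iW.
move=> y /iW iy; rewrite /t !framei invmx_scale ?bframe_unit//.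
by rewrite -!scalemxAl -!scalemxAr (mulKVmx (bframe_unit iy)).
Qed.

Lemma cliffE u s : cliff Sp u s =
  cplx_op (fun (u : sec r) (s : sec m) x => sp_c Sp x (u x) *m s x) u s.
Proof.
apply/funext => x; apply/matrixP => i j; rewrite /cliff /cplx_op /smk !mxE.
apply: complex_eq; rewrite /= raddf_sum /=.
  rewrite -sumrB; apply: eq_bigr => k _; rewrite !mxE.
  by case: (s x k j) => a b /=; ring.
rewrite -big_split; apply: eq_bigr => k _; rewrite !mxE.
by case: (s x k j) => a b /=; ring.
Qed.

Lemma cliff_smooth U u s : open U -> csmooth_sec (gEF D) U u ->
  csmooth_spinor Sp U s -> csmooth_spinor Sp U (cliff Sp u s).
Proof.
move=> oU su ss; rewrite cliffE; apply: cplx_op_smooth su ss => //.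
- exact: sp_open.
- by move=> ? ?; exact: sp_c_bundle_smooth.
Qed.

Lemma cliff_linl (f : M -> C) u v s x :
  cliff Sp (fun x => f x *: u x + v x) s x = f x *: cliff Sp u s x + cliff Sp v s x.
Proof.
rewrite /cliff scalemxAl -mulmxDl; congr (_ *m _).
have := sre_lin f u v => /(congr1 (fun g => g x)); rewrite /sadd /sscale => ->.
have := sim_lin f u v => /(congr1 (fun g => g x)); rewrite /sadd /sscale => ->.
have L := @sp_c_linear _ _ _ _ _ _ Sp x.
have L0 a u1 : sp_c Sp x (a *: u1) = a *: sp_c Sp x u1.
  have z : sp_c Sp x 0 = 0 by have := L (-1) 0 0; rewrite scaleN1r oppr0 addr0 scaleN1r addNr.
  by have := L a u1 0; rewrite !addr0 z addr0.
rewrite !L L0.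
apply/matrixP => i j; rewrite !mxE; case: (f x) => a b /=.
by apply: complex_eq => /=; ring.
Qed.

(** The Leibniz rule survives the change of direction bundle because [giota] intertwines the
    anchors, hence both directions differentiate functions alike. *)
Lemma nabSp_conn : E_connection (gEB D) B
  (fun e s => sp_nab Sp (happ (giota D) e) s).
Proof.
have [H _] := sp_nabP Sp.
have [_ si _ _ ia _] := giota_iso D.
have sm U e : open U -> smooth_sec (gEB D) U e -> smooth_sec (gEF D) U (happ (giota D) e).
  by move=> oU; exact: smooth_happ.
split.
- move=> U e s oU se ss; exact: (ec_smooth H oU (sm _ _ oU se) ss).
- move=> U e e' s s' oU se se' ss ss' ee.
  apply: (ec_local H oU (sm _ _ oU se) (sm _ _ oU se')) => //.
  by move=> x Ux; rewrite /happ ee.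
- move=> U e e' s oU se se' ss.
  have -> : happ (giota D) (sadd e e') =
      sadd (happ (giota D) e) (happ (giota D) e').
    by apply/funext => x; rewrite /happ /sadd mulmxDr.
  exact: (ec_addl H oU (sm _ _ oU se) (sm _ _ oU se') ss).
- move=> U f e s oU sf se ss.
  have -> : happ (giota D) (sscale f e) = sscale f (happ (giota D) e).
    by apply/funext => x; rewrite /happ /sscale scalemxAr.
  exact: (ec_scalel H oU sf (sm _ _ oU se) ss).
- move=> U e s s' oU se ss ss'; exact: (ec_addr H oU (sm _ _ oU se) ss ss').
- move=> U f e s oU sf se ss; have := ec_leibniz H oU sf (sm _ _ oU se) ss.
  have -> : ca_act (gEF D) (happ (giota D) e) = ca_act (gEB D) e; last by [].
  apply/funext => g; rewrite /ca_act; congr (vact _ g).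
  by apply/funext => x; rewrite /happ mulmxA ia.
Qed.

Lemma prBF_lin (f : M -> C) (Z Z' : csec (r + r)) :
  prB (fun x => f x *: Z x + Z' x) = (fun x => f x *: prB Z x + prB Z' x) /\
  prF (fun x => f x *: Z x + Z' x) = (fun x => f x *: prF Z x + prF Z' x).
Proof.
by split; apply/funext => x; rewrite /prB /prF linearP.
Qed.

Lemma csmooth_BF_lin U f Z Z' : open U -> csmooth_fun U f ->
  csmooth_BF D U Z -> csmooth_BF D U Z' ->
  csmooth_BF D U (fun x => f x *: Z x + Z' x).
Proof.
move=> oU sf [z1 z2] [z1' z2']; rewrite /csmooth_BF; have [-> ->] := prBF_lin f Z Z'.
by split; apply: csmooth_sec_lin => //; [exact: EB_open|exact: EF_open].
Qed.

Lemma csmooth_BF_restrict U V Z : V `<=` U -> csmooth_BF D U Z -> csmooth_BF D V Z.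
Proof. by move=> VU [? ?]; split; apply: csmooth_sec_restrict VU _. Qed.

Lemma nabBF_smooth U e Z : open U -> csmooth_sec (gEB D) U e ->
  csmooth_BF D U Z -> csmooth_BF D U (nabBF D e Z).
Proof.
move=> oU se [sB sF]; have HB := lc_conn (gnabB_LC D).
have [_ si si' _ _ _] := giota_iso D.
split.
  have -> : prB (nabBF D e Z) = cplx_op (gnabB D) e (prB Z).
    by apply/funext => x; rewrite /prB /nabBF col_mxKu.
  apply: cplx_op_smooth se sB => //; [exact: EB_open|].
  by move=> ? ?; exact: (ec_smooth HB oU).
have -> : prF (nabBF D e Z) = cplx_op (nabF D) e (prF Z).
  by apply/funext => x; rewrite /prF /nabBF col_mxKd.
apply: cplx_op_smooth se sF => //; [exact: EF_open|].
move=> e' s' se' ss'; apply: smooth_happ => //; apply: (ec_smooth HB oU) => //.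
exact: smooth_happ si' ss'.
Qed.

Lemma A_op_smooth U Z s : open U -> csmooth_BF D U Z -> csmooth_spinor Sp U s ->
  csmooth_spinor Sp U (A_op Sp Z s).
Proof.
move=> oU [zB zF] ss; apply: csmooth_sec_add => //; first exact: sp_open.
  apply: cplx_op_smooth zB ss => //; [exact: sp_open|].
  by move=> ? ?; exact: (ec_smooth nabSp_conn oU).
exact: cliff_smooth.
Qed.

Lemma A_op_ext U Z Z' s s' : open U -> csmooth_BF D U Z -> csmooth_BF D U Z' ->
  csmooth_spinor Sp U s -> csmooth_spinor Sp U s' -> eq_on U Z Z' -> eq_on U s s' ->
  eq_on U (A_op Sp Z s) (A_op Sp Z' s').
Proof.
move=> oU [zB zF] [zB' zF'] ss ss' ZZ sss x Ux; rewrite /A_op; congr (_ + _).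
  apply: (cplx_nab_local nabSp_conn oU zB zB' ss ss') => // y Uy.
  by rewrite /prB ZZ.
by rewrite /cliff /sre /sim /prF ZZ// sss.
Qed.

Lemma A_op_linl U f Z Z' s : open U -> csmooth_fun U f -> csmooth_BF D U Z ->
  csmooth_BF D U Z' -> csmooth_spinor Sp U s ->
  eq_on U (A_op Sp (fun x => f x *: Z x + Z' x) s)
          (fun x => f x *: A_op Sp Z s x + A_op Sp Z' s x).
Proof.
move=> oU sf [zB zF] [zB' zF'] ss x Ux; rewrite /A_op; have [-> ->] := prBF_lin f Z Z'.
rewrite cliff_linl /nabSp (cplx_nab_linl nabSp_conn oU sf zB zB' ss Ux).
by rewrite scalerDr addrACA.
Qed.

Lemma A_op_leibniz U f Z s t : open U -> csmooth_fun U f -> csmooth_BF D U Z ->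
  csmooth_spinor Sp U s -> csmooth_spinor Sp U t ->
  eq_on U (A_op Sp Z (fun x => f x *: s x + t x))
    (fun x => cact (gEB D) (prB Z) f x *: s x + f x *: A_op Sp Z s x + A_op Sp Z t x).
Proof.
move=> oU sf [zB zF] ss st x Ux; rewrite /A_op /nabSp.
rewrite (cplx_nab_leibniz sp_open nabSp_conn oU sf zB ss st Ux).
rewrite /cliff mulmxDr -scalemxAr scalerDr -!addrA; congr (_ + (_ + _)).
by rewrite addrCA.
Qed.

End Operators.

(** * Tensor fields *)

Section Tensor_algebra.
Context {R : realType} {n r : nat} {M : manifold R n}.
Local Notation C := R[i].
Local Notation RC := (real_complex R).
Local Notation tfield := (@tfield R n M r).
Implicit Types (t u : tfield) (x : M) (w : seq 'I_(r + r)) (f : M -> C).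

(** The left quotient of a noncommutative polynomial by a letter; [tmul_cons] is its product rule
    and drives the inductions on words. *)
Definition tshift (a : 'I_(r + r)) t : tfield := fun x w => t x (a :: w).

Lemma tmul_nil t u x : tmul t u x [::] = t x [::] * u x [::].
Proof. by rewrite /tmul big_ord1. Qed.

Lemma tmul_cons t u x a w :
  tmul t u x (a :: w) = t x [::] * u x (a :: w) + tmul (tshift a t) u x w.
Proof. by rewrite /tmul big_ord_recl. Qed.

Lemma tmul_lin_l f t t' u x w :
  tmul (tadd (tscale f t) t') u x w = f x * tmul t u x w + tmul t' u x w.
Proof.
rewrite /tmul mulr_sumr -big_split; apply: eq_bigr => i _ /=.
by rewrite /tadd /tscale mulrDl mulrA.
Qed.

Lemma tmul_lin_r f t u u' x w :
  tmul t (tadd (tscale f u) u') x w = f x * tmul t u x w + tmul t u' x w.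
Proof.
rewrite /tmul mulr_sumr -big_split; apply: eq_bigr => i _ /=.
by rewrite /tadd /tscale; ring.
Qed.

Lemma tmul_tfun f t x w : tmul (tfun f) t x w = f x * t x w.
Proof.
rewrite /tmul big_ord_recl /= take0 drop0 big1 ?addr0// => i _.
by case: w i => [|a w] [i //= ii]; rewrite mul0r.
Qed.

Lemma tmul_tvec (Z : csec (r + r)) t x w :
  tmul (tvec Z) t x w = if w is a :: w' then Z x a ord0 * t x w' else 0.
Proof.
case: w => [|a w]; first by rewrite tmul_nil mul0r.
rewrite tmul_cons mul0r add0r -(tmul_tfun (fun x => Z x a ord0)).
by congr (tmul _ _ _ _); apply/funext => y; apply/funext => -[].
Qed.

Lemma tmulA t u v x w : tmul t (tmul u v) x w = tmul (tmul t u) v x w.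
Proof.
elim: w t u => [|a w IH] t u; first by rewrite !tmul_nil mulrA.
rewrite !tmul_cons IH mulrDr -addrA tmul_nil mulrA; congr (_ + _).
rewrite -(tmul_lin_l (fun x => t x [::])); congr (tmul _ _ _ _).
by apply/funext => y; apply/funext => w'; rewrite /tshift tmul_cons.
Qed.

Lemma tmul_ext t t' u u' x : t x = t' x -> u x = u' x -> tmul t u x = tmul t' u' x.
Proof. by move=> tt uu; apply/funext => w; rewrite /tmul tt uu. Qed.

Context (D : geometric_data (M := M) r).
Implicit Types (i : bI (gEB D)) (j : bI (gEF D)).

Definition BFmx i j x : 'M[R]_(r + r) := block_mx (bframe i x) 0 0 (bframe j x).
Definition cBFmx i j x : 'M[C]_(r + r) := map_mx RC (BFmx i j x).
Definition cBFinv i j x : 'M[C]_(r + r) := map_mx RC (invmx (BFmx i j x)).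

Definition BFframe i j (l : 'I_(r + r)) : csec (M := M) (r + r) :=
  fun x => col l (cBFmx i j x).

(** Contraction of the first slot with the [l]-th vector of the dual frame, whose components form
    the [l]-th row of [cBFinv]. *)
Definition contr i j (l : 'I_(r + r)) t : tfield :=
  fun x w => \sum_a cBFinv i j x l a * t x (a :: w).

Lemma BFmx_unit i j x : bdom i x -> bdom j x -> BFmx i j x \in unitmx.
Proof.
move=> ix jx; rewrite block_diag_mx_unit; apply/andP; split.
  exact: (@bframe_unit _ _ _ _ (gEB D)).
exact: (@bframe_unit _ _ _ _ (gEF D)).
Qed.

Lemma cBFmxV i j x : bdom i x -> bdom j x -> cBFmx i j x *m cBFinv i j x = 1%:M.
Proof.
by move=> ix jx; rewrite /cBFinv /cBFmx -map_mxM (mulmxV (BFmx_unit ix jx)) map_mx1.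
Qed.

Lemma contr_lin i j l f t t' x w :
  contr i j l (tadd (tscale f t) t') x w = f x * contr i j l t x w + contr i j l t' x w.
Proof.
rewrite /contr mulr_sumr -big_split; apply: eq_bigr => a _ /=.
by rewrite /tadd /tscale; ring.
Qed.

Lemma contr_tvec i j l Z t x w :
  contr i j l (tmul (tvec Z) t) x w = (cBFinv i j x *m Z x) l ord0 * t x w.
Proof.
rewrite /contr mxE mulr_suml; apply: eq_bigr => a _.
by rewrite tmul_tvec mulrA.
Qed.

(** Inserting [cBFmx *m cBFinv = 1] in the first slot expands it in the frame. The empty word has no
    slot, hence the separate term of degree zero. *)
Lemma tens_decomp i j t x w : bdom i x -> bdom j x ->
  t x w = tfun (fun y => t y [::]) x w
          + \sum_l tmul (tvec (BFframe i j l)) (contr i j l t) x w.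
Proof.
move=> ix jx; case: w => [|a w] /=.
  by rewrite big1 ?addr0// => l _; rewrite tmul_tvec.
rewrite add0r; transitivity (\sum_b (cBFmx i j x *m cBFinv i j x) a b * t x (b :: w)).
  rewrite cBFmxV// (bigD1 a)//= mxE eqxx mul1r big1 ?addr0// => b ba.
  by rewrite mxE eq_sym (negPf ba) mul0r.
under [LHS]eq_bigr => b _ do rewrite mxE mulr_suml.
rewrite exchange_big; apply: eq_bigr => l _; rewrite tmul_tvec [X in _ = X * _]mxE mulr_sumr.
by apply: eq_bigr => b _; rewrite mulrA.
Qed.

Lemma vec_decomp i j (Z : csec (r + r)) x : bdom i x -> bdom j x ->
  Z x = \sum_l (cBFinv i j x *m Z x) l ord0 *: BFframe i j l x.
Proof.
move=> ix jx; rewrite -[LHS]mul1mx -(cBFmxV ix jx) -mulmxA.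
apply/matrixP => a b; rewrite [b]ord1 mxE summxE; apply: eq_bigr => l _.
by rewrite !mxE mulrC.
Qed.

Lemma tcoef_nil i j t x : tcoef i j t x [::] = t x [::].
Proof.
rewrite /tcoef /= (big_pred1 [tuple]); first by rewrite big_ord0 mul1r.
by move=> u; rewrite (tuple0 u); apply/esym; exact: eqxx.
Qed.

(** Frame coefficients are iterated contractions: splitting a tuple into head and tail turns the sum
    in [tcoef] into a recursion on the word. *)
Lemma tcoef_cons i j t x l w :
  tcoef i j t x (l :: w) = tcoef i j (contr i j l t) x w.
Proof.
rewrite /tcoef /=.
pose F (p : 'I_(r + r) * (size w).-tuple 'I_(r + r)) : (size w).+1.-tuple 'I_(r + r) :=
  [tuple of p.1 :: p.2].
have bF : bijective F.
  exists (fun v => (thead v, [tuple of behead v])).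
    by move=> [a u]; congr (_, _); apply: val_inj.
  by move=> u; apply: val_inj; rewrite /= [in RHS](tuple_eta u).
rewrite (reindex F) /=; last exact: onW_bij.
rewrite -(pair_bigA _ (fun a v => (\prod_(k < (size w).+1) cBFinv i j x
   (tnth (in_tuple (l :: w)) k) (tnth (F (a, v)) k)) * t x (a :: v))) /=.
rewrite exchange_big; apply: eq_bigr => u _; rewrite /contr mulr_sumr.
apply: eq_bigr => a _; rewrite big_ord_recl.
have -> : tnth (in_tuple (l :: w)) ord0 = l by [].
have -> : tnth (F (a, u)) ord0 = a by [].
rewrite mulrA; congr (_ * _); rewrite mulrC; congr (_ * _).
apply: eq_bigr => k _; congr (map_mx _ _ _ _); rewrite !(tnth_nth l)//=.
Qed.

Lemma tcoef_sum (I : Type) (s : seq I) i j t (c : I -> C) (t' : I -> tfield) x w :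
  (forall w, t x w = \sum_(l <- s) c l * t' l x w) ->
  tcoef i j t x w = \sum_(l <- s) c l * tcoef i j (t' l) x w.
Proof.
move=> tE; rewrite /tcoef; under eq_bigr do rewrite tE mulr_sumr.
rewrite exchange_big; apply: eq_bigr => l _; rewrite mulr_sumr.
by apply: eq_bigr => u _; rewrite mulrCA.
Qed.

Lemma tcoef_ext i j t t' x w : t x = t' x -> tcoef i j t x w = tcoef i j t' x w.
Proof. by move=> tt; rewrite /tcoef tt. Qed.

Lemma tcoef_lin i j f t t' x w :
  tcoef i j (tadd (tscale f t) t') x w = f x * tcoef i j t x w + tcoef i j t' x w.
Proof.
rewrite /tcoef mulr_sumr -big_split; apply: eq_bigr => u _ /=.
by rewrite /tadd /tscale; ring.
Qed.

Lemma tcoef_tfun i j f x w : tcoef i j (tfun f) x w = tfun (r := r) f x w.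
Proof.
case: w => [|l w]; first by rewrite tcoef_nil.
by rewrite /tcoef big1// => u _; case: (tupleP u) => a u'; rewrite mulr0.
Qed.

(** Contraction obeys the same product rule as the left quotient, so both sides follow one recursion
    on the word. *)
Lemma tcoef_tmul i j t u x w :
  tcoef i j (tmul t u) x w = tmul (tcoef i j t) (tcoef i j u) x w.
Proof.
elim: w t => [|l w IH] t; first by rewrite tmul_nil !tcoef_nil tmul_nil.
rewrite tcoef_cons tmul_cons tcoef_nil.
have -> : tcoef i j (contr i j l (tmul t u)) x w =
    tcoef i j (tadd (tscale (fun x => t x [::]) (contr i j l u)) (tmul (contr i j l t) u)) x w.
  apply: tcoef_ext; apply/funext => w'; rewrite /contr /tadd /tscale mulr_sumr.
  rewrite [X in _ + X]/tmul; under [X in _ + X]eq_bigr do rewrite mulr_suml.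
  rewrite exchange_big -big_split; apply: eq_bigr => a _ /=.
  rewrite tmul_cons mulrDr mulrCA; congr (_ + _).
  by rewrite /tmul mulr_sumr; apply: eq_bigr => k _; rewrite mulrA.
rewrite tcoef_lin IH -tcoef_cons; congr (_ + _).
by congr (tmul _ _ _ _); apply/funext => y; apply/funext => w'; rewrite -tcoef_cons.
Qed.

End Tensor_algebra.

(** * Smoothness and degree of tensor fields *)

Section Smooth_tensors.
Context {R : realType} {n r : nat} {M : manifold R n}.
Context (D : geometric_data (M := M) r).
Local Notation C := R[i].
Local Notation RC := (real_complex R).
Local Notation tfield := (@tfield R n M r).
Implicit Types (U V W : set M) (t u : tfield) (f : M -> C).
Implicit Types (i : bI (gEB D)) (j : bI (gEF D)).

Definition degle (k : nat) U t := forall x w, U x -> (k < size w)%N -> t x w = 0.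

Definition fdom i j : set M := bdom i `&` bdom j.

Lemma fdom_open i j : open (fdom i j).
Proof. by apply: openI; [exact: EB_open|exact: EF_open]. Qed.

Lemma degle_restrict k U V t : V `<=` U -> degle k U t -> degle k V t.
Proof. by move=> VU dt x w /VU; exact: dt. Qed.

Lemma degle_leq k k' U t : (k <= k')%N -> degle k U t -> degle k' U t.
Proof. by move=> kk dt x w Ux kw; apply: dt => //; exact: leq_ltn_trans kw. Qed.

Lemma degle_ext k U t t' : eq_on U t t' -> degle k U t -> degle k U t'.
Proof. by move=> tt dt x w Ux kw; rewrite -tt// dt. Qed.

Lemma degle_lin k U f t t' : degle k U t -> degle k U t' ->
  degle k U (tadd (tscale f t) t').
Proof.
by move=> dt dt' x w Ux kw; rewrite /tadd /tscale dt// dt'// mulr0 addr0.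
Qed.

Lemma degle_tfun k U f : degle k U (tfun f).
Proof. by move=> x [|a w]. Qed.

Lemma degle_tvec k U Z : degle k.+1 U (tvec Z).
Proof. by move=> x [|a [|b w]]. Qed.

Lemma degle_tmul k l U t u : degle k U t -> degle l U u -> degle (k + l) U (tmul t u).
Proof.
move=> dt du x w Ux kw; rewrite /tmul big1// => a _.
have [ka|ka] := ltnP k a.
  by rewrite dt ?mul0r// size_takel// -ltnS.
rewrite du ?mulr0// size_drop ltn_subRL; apply: leq_ltn_trans kw.
by rewrite leq_add2r.
Qed.

Lemma degle_contr k U i j l t : degle k.+1 U t -> degle k U (contr i j l t).
Proof. by move=> dt x w Ux kw; rewrite /contr big1// => a _; rewrite dt ?mulr0. Qed.

Lemma smooth_tens_restrict U V t : V `<=` U -> smooth_tens D U t -> smooth_tens D V t.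
Proof.
move=> VU [[d dt] st]; split; first by exists d; exact: degle_restrict VU dt.
by move=> i j w; apply: csmooth_fun_restrict (st i j w) => x [/VU].
Qed.

Lemma smooth_tens_lin U f t t' : open U -> csmooth_fun U f ->
  smooth_tens D U t -> smooth_tens D U t' -> smooth_tens D U (tadd (tscale f t) t').
Proof.
move=> oU sf [[d dt] st] [[d' dt'] st']; split.
  exists (maxn d d'); apply: degle_lin.
    by apply: degle_leq dt; exact: leq_maxl.
  by apply: degle_leq dt'; exact: leq_maxr.
move=> i j w; have oUV : open (U `&` fdom i j) by apply: openI => //; exact: fdom_open.
have H : csmooth_fun (U `&` fdom i j) f by apply: csmooth_fun_restrict sf => ? [].
apply: csmooth_fun_ext (csmooth_add oUV (csmooth_mul oUV H (st i j w)) (st' i j w)) => //.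
by move=> x _; rewrite tcoef_lin.
Qed.

Lemma smooth_tfun U f : csmooth_fun U f -> smooth_tens D U (tfun f).
Proof.
move=> sf; split; first by exists 0%N; exact: degle_tfun.
move=> i j [|a w]; under eq_fun do rewrite tcoef_tfun /=; last exact: csmooth_cst.
by apply: csmooth_fun_restrict sf => ? [].
Qed.

Lemma tfun0 : tfun (fun=> 0) = (fun _ _ => 0) :> tfield.
Proof. by apply/funext => x; apply/funext => -[]. Qed.

Lemma smooth_tens0 U : smooth_tens D U (fun _ _ => 0).
Proof. by rewrite -tfun0; apply/smooth_tfun/csmooth_cst. Qed.

Lemma tadd_scale1 t t' : tadd (tscale (fun=> 1) t) t' = tadd t t'.
Proof. by apply/funext => x; apply/funext => w; rewrite /tadd /tscale mul1r. Qed.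

Lemma tscale_add0 f t : tadd (tscale f t) (fun _ _ => 0) = tscale f t.
Proof. by apply/funext => x; apply/funext => w; rewrite /tadd addr0. Qed.

Lemma smooth_tadd U t t' : open U -> smooth_tens D U t -> smooth_tens D U t' ->
  smooth_tens D U (tadd t t').
Proof.
by move=> oU st st'; rewrite -tadd_scale1; apply: smooth_tens_lin => //; exact: csmooth_cst.
Qed.

Lemma smooth_tscale U f t : open U -> csmooth_fun U f -> smooth_tens D U t ->
  smooth_tens D U (tscale f t).
Proof.
by move=> oU sf st; rewrite -tscale_add0; apply: smooth_tens_lin => //; exact: smooth_tens0.
Qed.

Definition tsum (I : Type) (s : seq I) (t : I -> tfield) : tfield :=
  foldr (fun l => tadd (t l)) (fun _ _ => 0) s.

Lemma tsumE (I : Type) (s : seq I) (t : I -> tfield) x w :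
  tsum s t x w = \sum_(l <- s) t l x w.
Proof. by elim: s => [|a s IH]; rewrite ?big_nil ?big_cons//= /tadd IH. Qed.

Lemma smooth_tsum (I : Type) (s : seq I) U (t : I -> tfield) : open U ->
  (forall l, smooth_tens D U (t l)) -> smooth_tens D U (tsum s t).
Proof.
by move=> oU st; elim: s => [|a s IH] /=; [exact: smooth_tens0|exact: smooth_tadd].
Qed.

Lemma degle_tsum k (I : Type) (s : seq I) U (t : I -> tfield) :
  (forall l, degle k U (t l)) -> degle k U (tsum s t).
Proof.
by move=> dt x w Ux kw; rewrite tsumE big1// => l _; rewrite dt.
Qed.

Lemma smooth_tens_nil U t : smooth_tens D U t -> csmooth_fun U (fun x => t x [::]).
Proof.
move=> [_ st]; apply: csmooth_fun_local => x Ux.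
exists (U `&` fdom (bat (gEB D) x) (bat (gEF D) x)).
  by split=> //; split; exact: batP.
by have := st (bat (gEB D) x) (bat (gEF D) x) [::]; under eq_fun do rewrite tcoef_nil.
Qed.

Lemma smooth_tmul U t u : open U -> smooth_tens D U t -> smooth_tens D U u ->
  smooth_tens D U (tmul t u).
Proof.
move=> oU [[d dt] st] [[d' du] su]; split; first by exists (d + d')%N; exact: degle_tmul.
move=> i j w; under eq_fun do rewrite tcoef_tmul.
have oUV : open (U `&` fdom i j) by apply: openI => //; exact: fdom_open.
by apply: csmooth_sum => // a; apply: csmooth_mul.
Qed.

Lemma cBFinvE i j x (z : 'cV[C]_(r + r)) : fdom i j x ->
  cBFinv i j x *m z = col_mx (map_mx RC (invmx (bframe i x)) *m usubmx z)
                             (map_mx RC (invmx (bframe j x)) *m dsubmx z).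
Proof.
move=> [ix jx]; rewrite /cBFinv /BFmx invmx_block_diag; last exact: BFmx_unit.
by rewrite map_block_mx !raddf0 -{1}(vsubmxK z) mul_block_col !mul0mx addr0 add0r.
Qed.

Lemma BFcoef_smooth U i j l Z : open U -> csmooth_BF D U Z ->
  csmooth_fun (U `&` fdom i j) (fun x => (cBFinv i j x *m Z x) l ord0).
Proof.
move=> oU [/csmooth_secP zB /csmooth_secP zF].
have oUV : open (U `&` fdom i j) by apply: openI => //; exact: fdom_open.
case: (split_ordP l) => a ->.
  apply: csmooth_fun_ext (csmooth_fun_restrict _ (zB i a)) => //.
    by move=> x [_ xf]; rewrite (cBFinvE _ xf) col_mxEu.
  by move=> x [? []].
apply: csmooth_fun_ext (csmooth_fun_restrict _ (zF j a)) => //.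
  by move=> x [_ xf]; rewrite (cBFinvE _ xf) col_mxEd.
by move=> x [? []].
Qed.

Lemma smooth_tvec U Z : open U -> csmooth_BF D U Z -> smooth_tens D U (tvec Z).
Proof.
move=> oU sZ; split; first by exists 1%N; exact: degle_tvec.
have oUV i j : open (U `&` fdom i j) by apply: openI => //; exact: fdom_open.
have E : tvec Z = tmul (tvec Z) (tfun (fun=> 1)).
  apply/funext => x; apply/funext => w; rewrite tmul_tvec.
  by case: w => [|a [|b w]] //=; rewrite ?mulr1 ?mulr0.
move=> i j [|l w]; first by under eq_fun do rewrite tcoef_nil; exact: csmooth_cst.
have F x : tcoef i j (tvec Z) x (l :: w) =
    (cBFinv i j x *m Z x) l ord0 * tfun (r := r) (fun=> 1) x w.
  rewrite tcoef_cons; pose c y := (cBFinv i j y *m Z y) l ord0.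
  rewrite (_ : contr i j l (tvec Z) = tadd (tscale c (tfun (fun=> 1))) (fun _ _ => 0)).
    by rewrite tcoef_lin tcoef_tfun -tfun0 tcoef_tfun tfun0 addr0.
  by apply/funext => y; apply/funext => w'; rewrite {1}E contr_tvec /tadd /tscale addr0.
under eq_fun do rewrite F; case: w {F} => [|a w] /=.
  by under eq_fun do rewrite mulr1; exact: BFcoef_smooth.
by under eq_fun do rewrite mulr0; exact: csmooth_cst.
Qed.

Lemma BFframe_smooth i j l : csmooth_BF D (fdom i j) (BFframe i j l).
Proof.
have fi : fdom i j `<=` bdom i by move=> ? [].
have fj : fdom i j `<=` bdom j by move=> ? [].
have oF := fdom_open i j.
case: (split_ordP l) => a ->; split.
- rewrite (_ : prB _ = frame_sec i a).
    by apply: csmooth_sec_restrict (@frame_sec_smooth _ _ _ _ (gEB D) i a).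
  apply/funext => x; apply/matrixP => b c.
  by rewrite /cBFmx /BFmx 3!mxE block_mxEul /frame_sec !mxE.
- rewrite (_ : prF _ = (fun=> 0)); first exact: csmooth_sec0.
  by apply/funext => x; apply/matrixP => b c; rewrite 3!mxE block_mxEdl !mxE.
- rewrite (_ : prB _ = (fun=> 0)); first exact: csmooth_sec0.
  by apply/funext => x; apply/matrixP => b c; rewrite 3!mxE block_mxEur !mxE.
- rewrite (_ : prF _ = frame_sec j a).
    by apply: csmooth_sec_restrict (@frame_sec_smooth _ _ _ _ (gEF D) j a).
  apply/funext => x; apply/matrixP => b c.
  by rewrite /cBFmx /BFmx 3!mxE block_mxEdr /frame_sec !mxE.
Qed.

(** Smoothness has to be tested in every frame. In another frame the coefficients are those of [t]
    on words longer by one letter, combined with entries of the transition matrix between the two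
    frames. *)
Lemma smooth_contr U i j l t : open U -> smooth_tens D U t ->
  smooth_tens D (U `&` fdom i j) (contr i j l t).
Proof.
move=> oU [[d dt] st]; split.
  exists d; apply: (@degle_restrict d U) => [x []//|]; apply: degle_contr.
  by apply: degle_leq dt.
move=> i' j' w; set V := _ `&` _ `&` _.
have oUV : open V by apply: openI; [apply: openI => //|]; exact: fdom_open.
have E x : V x -> tcoef i' j' (contr i j l t) x w =
    \sum_l' (cBFinv i j x *m cBFmx i' j' x) l l' * tcoef i' j' t x (l' :: w).
  move=> [[Ux fx] fx']; under eq_bigr do rewrite tcoef_cons.
  apply: tcoef_sum => {}w; rewrite /contr.
  under [RHS]eq_bigr do rewrite mulr_sumr.
  rewrite exchange_big; apply: eq_bigr => a _ /=.
  under eq_bigr do rewrite mulrA.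
  rewrite -mulr_suml; congr (_ * _).
  transitivity ((cBFinv i j x *m cBFmx i' j' x *m cBFinv i' j' x) l a);
    last by rewrite [LHS]mxE.
  by case: fx' => ix jx; rewrite -mulmxA cBFmxV// mulmx1.
apply: csmooth_fun_ext (fun x Vx => esym (E x Vx)) _ => //.
apply: csmooth_sum => // l'; apply: csmooth_mul => //; last first.
  by apply: csmooth_fun_restrict (st i' j' (l' :: w)) => x [[]].
have H := BFcoef_smooth i j l (fdom_open i' j') (BFframe_smooth i' j' l').
apply: csmooth_fun_ext (csmooth_fun_restrict _ H) => //.
  by move=> x _; rewrite !mxE; apply: eq_bigr => b _; rewrite !mxE.
by move=> x [[]].
Qed.

Lemma smooth_tens_cutoff U V W chi t : open U -> open V -> open W ->
  csmooth_fun U chi -> (forall y, V y \/ W y) -> (forall y, W y -> chi y = 0) ->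
  smooth_tens D (U `&` V) t -> smooth_tens D U (tscale chi t).
Proof.
move=> oU oV oW sc VW cW [[d dt] st]; split.
  exists d => x w Ux dw; rewrite /tscale; have [Vx|Wx] := VW x.
    by rewrite dt ?mulr0.
  by rewrite cW// mul0r.
move=> i j w; rewrite -tscale_add0.
under eq_fun do rewrite tcoef_lin -tfun0 tcoef_tfun tfun0 addr0.
apply: (csmooth_cutoff (V := V) (W := W)) => //.
- by apply: openI => //; exact: fdom_open.
- by apply: csmooth_fun_restrict sc => ? [].
- by rewrite setIAC; exact: st.
Qed.

Lemma csmooth_BF_cutoff U V W chi Z : open U -> open V -> open W ->
  csmooth_fun U chi -> (forall y, V y \/ W y) -> (forall y, W y -> chi y = 0) ->
  csmooth_BF D (U `&` V) Z -> csmooth_BF D U (fun x => chi x *: Z x).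
Proof.
move=> oU oV oW sc VW cW [zB zF]; split.
  rewrite (_ : prB _ = fun x => chi x *: prB Z x).
    by apply: (csmooth_sec_cutoff _ oU oV oW sc VW cW) => //; exact: EB_open.
  by apply/funext => x; rewrite /prB linearZ.
rewrite (_ : prF _ = fun x => chi x *: prF Z x).
  by apply: (csmooth_sec_cutoff _ oU oV oW sc VW cW) => //; exact: EF_open.
by apply/funext => x; rewrite /prF linearZ.
Qed.

End Smooth_tensors.

(** * The induced connection on tensor fields *)

Section Tensor_connection.
Context {R : realType} {n r : nat} {M : manifold R n}.
Context (D : geometric_data (M := M) r).
Local Notation C := R[i].
Local Notation tfield := (@tfield R n M r).
Context (nabT : csec r -> tfield -> tfield) (hT : tensor_connection D nabT).
Implicit Types (U V W : set M) (t u : tfield) (f : M -> C) (e : csec (M := M) r).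
Local Notation EB := (gEB D).

Lemma tmul_tfunE f t : tmul (tfun f) t = tscale f t.
Proof. by apply/funext => x; apply/funext => w; rewrite tmul_tfun. Qed.

Lemma tfun_scale f : tfun f = tscale f tone :> tfield.
Proof.
by apply/funext => x; apply/funext => -[|a w]; rewrite /tscale /= ?mulr1 ?mulr0.
Qed.

(** The derivative of [f] is the degree zero part of [nabT e (tfun f)], so its smoothness is read
    off from [tc_smooth]. *)
Lemma cact_smooth U e f : open U -> csmooth_sec EB U e -> csmooth_fun U f ->
  csmooth_fun U (cact EB e f).
Proof.
move=> oU se sf; have := smooth_tens_nil (tc_smooth hT oU se (smooth_tfun D sf)).
by apply: csmooth_fun_ext => // x Ux; rewrite (tc_fun hT oU se sf Ux).
Qed.

(** Scaling by [f] is multiplication by [tfun f], so the rule for function multiples is a case of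
    [tc_leibniz]. *)
Lemma nabT_lin U e f t t' : open U -> csmooth_sec EB U e -> csmooth_fun U f ->
  smooth_tens D U t -> smooth_tens D U t' ->
  eq_on U (nabT e (tadd (tscale f t) t'))
    (tadd (tscale (cact EB e f) t) (tadd (tscale f (nabT e t)) (nabT e t'))).
Proof.
move=> oU se sf st st' x Ux; have sft := smooth_tscale oU sf st.
have E : nabT e (tscale f t) x = tadd (tscale (cact EB e f) t) (tscale f (nabT e t)) x.
  rewrite -(tmul_tfunE f t) (tc_leibniz hT oU se (smooth_tfun D sf) st Ux).
  rewrite -(tmul_tfunE (cact EB e f)) -(tmul_tfunE f); apply/funext => w.
  rewrite /tadd; congr (_ + _); congr (_ w).
  by apply: tmul_ext => //; exact: (tc_fun hT oU se sf Ux).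
rewrite (tc_addr hT oU se sft st' Ux); apply/funext => w.
by rewrite /tadd E /tadd addrA.
Qed.

Lemma nabT0 U e : open U -> csmooth_sec EB U e ->
  eq_on U (nabT e (fun _ _ => 0)) (fun _ _ => 0).
Proof.
move=> oU se x Ux; rewrite -tfun0 (tc_fun hT oU se (csmooth_cst U 0) Ux).
by rewrite cact_cst tfun0.
Qed.

Lemma nabT_tsum (I : Type) (s : seq I) U e (t : I -> tfield) : open U ->
  csmooth_sec EB U e -> (forall l, smooth_tens D U (t l)) ->
  eq_on U (nabT e (tsum s t)) (tsum s (fun l => nabT e (t l))).
Proof.
move=> oU se st x Ux; elim: s => [|a s IH] /=; first by rewrite (nabT0 oU se Ux).
rewrite (tc_addr hT oU se (st a) (smooth_tsum s oU st) Ux).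
by apply/funext => w; rewrite /tadd IH.
Qed.

Lemma tens_decomp_tsum U (i : bI EB) (j : bI (gEF D)) t : U `<=` fdom i j ->
  eq_on U t (tadd (tfun (fun y => t y [::]))
    (tsum (index_enum 'I_(r + r)) (fun l => tmul (tvec (BFframe i j l)) (contr i j l t)))).
Proof.
move=> Uf x /Uf[ix jx]; apply/funext => w.
by rewrite /tadd tsumE; exact: tens_decomp.
Qed.

Lemma degle0 U t : degle 0 U t -> eq_on U t (tfun (fun y => t y [::])).
Proof. by move=> dt x Ux; apply/funext => -[|a w] //=; rewrite dt. Qed.

Lemma smooth_contr_sub U (i : bI EB) (j : bI (gEF D)) l t : open U -> U `<=` fdom i j ->
  smooth_tens D U t -> smooth_tens D U (contr i j l t).
Proof.
by move=> oU Uf st; have := smooth_contr i j l oU st; rewrite setIidl.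
Qed.

(** The axioms describe [nabT] in degrees 0 and 1 and on products. Near each point [t] is therefore
    decomposed along a frame, and the bound follows by induction for the contractions, which have
    lower degree. The open set varies in the induction because it shrinks to a frame domain. *)
Lemma degle_nabT k U e t : open U -> csmooth_sec EB U e -> smooth_tens D U t ->
  degle k U t -> degle k U (nabT e t).
Proof.
elim: k U t => [|k IH] U t oU se st dt.
  have s0 := smooth_tens_nil st.
  have E : eq_on U (nabT e t) (tfun (cact EB e (fun y => t y [::]))).
    move=> x Ux; rewrite -(tc_fun hT oU se s0 Ux).
    exact: (tc_local hT oU se se st (smooth_tfun D s0) _ (degle0 dt)).
  apply: (degle_ext (t := tfun (cact EB e (fun y => t y [::])))); last exact: degle_tfun.
  by move=> x Ux; rewrite E.
move=> x w Ux kw; pose i := bat EB x; pose j := bat (gEF D) x.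
have fx : fdom i j x by split; exact: batP.
pose V := U `&` fdom i j; have VU : V `<=` U by move=> ? [].
have Vf : V `<=` fdom i j by move=> ? [].
have oV : open V by apply: openI => //; exact: fdom_open.
have Vx : V x by [].
have seV := csmooth_sec_restrict VU se; have stV := smooth_tens_restrict VU st.
have sF l : csmooth_BF D V (BFframe i j l).
  by apply: csmooth_BF_restrict Vf _; exact: BFframe_smooth.
have sc l : smooth_tens D V (contr i j l t) by exact: smooth_contr_sub.
have sFc l : smooth_tens D V (tmul (tvec (BFframe i j l)) (contr i j l t)).
  by apply: smooth_tmul => //; exact: smooth_tvec.
have s0 := smooth_tfun D (smooth_tens_nil stV).
have ss := smooth_tsum (index_enum 'I_(r + r)) oV sFc.
rewrite (tc_local hT oV seV seV stV (smooth_tadd oV s0 ss) _ (tens_decomp_tsum t Vf) Vx)//.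
rewrite (tc_addr hT oV seV s0 ss Vx) /tadd (nabT_tsum _ oV seV sFc Vx).
rewrite (tc_fun hT oV seV (smooth_tens_nil stV) Vx) tsumE.
rewrite big1 ?addr0; first by case: w kw.
move=> l _; rewrite (tc_leibniz hT oV seV (smooth_tvec oV (sF l)) (sc l) Vx) /tadd.
rewrite tmul_tvec; case: w kw => [|a w]//=; rewrite ltnS => kw.
rewrite (IH V _ oV seV (sc l))// ?mulr0 ?addr0; last first.
  by apply: degle_contr; exact: degle_restrict VU dt.
rewrite (_ : tmul _ _ x _ = tmul (tvec (nabBF D e (BFframe i j l))) (contr i j l t) x (a :: w)).
  by rewrite tmul_tvec (degle_contr i j l (degle_restrict VU dt)) ?mulr0.
by congr (_ (a :: w)); apply: tmul_ext => //; exact: (tc_vec hT oV seV (sF l) Vx).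
Qed.

Lemma degle_tprod U Zs : degle (size Zs) U (tprod (r := r) Zs).
Proof.
elim: Zs => [|Z Zs IH]; first exact: degle_tfun.
by rewrite /= -add1n; apply: degle_tmul => //; exact: degle_tvec.
Qed.

Lemma smooth_tprod U Zs : open U -> all_smooth D U Zs -> smooth_tens D U (tprod Zs).
Proof.
move=> oU; elim: Zs => [|Z Zs IH] /=; first by move=> _; apply/smooth_tfun/csmooth_cst.
by move=> [sZ sZs]; apply: smooth_tmul => //; [exact: smooth_tvec|exact: IH].
Qed.

Lemma all_smooth_set_nth U d Zs k Z : all_smooth D U Zs -> csmooth_BF D U Z ->
  (k < size Zs)%N -> all_smooth D U (set_nth d Zs k Z).
Proof.
elim: Zs k => [|Z0 Zs IH] [|k]//= [sZ0 sZs] sZ; first by split.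
by rewrite ltnS => kZ; split => //; exact: IH.
Qed.

Lemma all_smooth_nth U d Zs k : all_smooth D U Zs -> (k < size Zs)%N ->
  csmooth_BF D U (nth d Zs k).
Proof. by elim: Zs k => [|Z0 Zs IH] [|k]//= [sZ0 sZs]//; exact: IH. Qed.

(** Iterating the Leibniz rule differentiates one factor at a time; this is the sum that [A_iter]
    subtracts. *)
Lemma nabT_tprod U e d Zs : open U -> csmooth_sec EB U e -> all_smooth D U Zs ->
  eq_on U (nabT e (tprod Zs)) (tsum (index_enum 'I_(size Zs))
    (fun j => tprod (set_nth d Zs j (nabBF D e (nth d Zs j))))).
Proof.
move=> oU se; elim: Zs => [|Z Zs IH] /=.
  move=> _ x Ux; rewrite (tc_fun hT oU se (csmooth_cst U 1) Ux) cact_cst tfun0.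
  by apply/funext => w; rewrite tsumE big_ord0.
move=> [sZ sZs] x Ux.
rewrite (tc_leibniz hT oU se (smooth_tvec oU sZ) (smooth_tprod oU sZs) Ux).
apply/funext => w; rewrite tsumE big_ord_recl /= /tadd; congr (_ + _).
  by congr (_ w); apply: tmul_ext => //; exact: (tc_vec hT oU se sZ Ux).
rewrite tmul_tvec; under [RHS]eq_bigr do rewrite tmul_tvec.
case: w => [|a w]; first by rewrite big1.
by rewrite (IH sZs x Ux) tsumE mulr_sumr.
Qed.

End Tensor_connection.

(** * Uniqueness *)

Section Uniqueness.
Context {R : realType} {n r m : nat} {M : manifold R n}.
Context (D : geometric_data (M := M) r).
Local Notation C := R[i].
Local Notation tfield := (@tfield R n M r).
Implicit Types (U V W : set M) (t u : tfield) (f : M -> C).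
Implicit Types Phi : tfield -> @csec R n M m.

(** The bound [k] makes an induction possible: with a first factor of degree p fixed,
    [t |-> Phi (tmul u t)] is tensorial for bounds smaller by p. *)
Record tensorial (k : nat) U Phi : Prop := Tensorial {
  tensorial_ext : forall t t', smooth_tens D U t -> smooth_tens D U t' ->
    degle k U t -> degle k U t' -> eq_on U t t' -> eq_on U (Phi t) (Phi t');
  tensorial_lin : forall f t t', csmooth_fun U f -> smooth_tens D U t -> smooth_tens D U t' ->
    degle k U t -> degle k U t' ->
    eq_on U (Phi (tadd (tscale f t) t')) (fun x => f x *: Phi t x + Phi t' x) }.

Lemma tensorial_leq k k' U Phi : (k <= k')%N -> tensorial k' U Phi -> tensorial k U Phi.
Proof.
move=> kk [le ll]; split.
  by move=> t t' st st' dt dt'; apply: le => //; apply: degle_leq kk _.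
by move=> f t t' sf st st' dt dt'; apply: ll => //; apply: degle_leq kk _.
Qed.

Section Tensorial.
Variables (k : nat) (U : set M) (Phi : tfield -> @csec R n M m).
Hypotheses (oU : open U) (HPhi : tensorial k U Phi).

Lemma tensorial_add t t' : smooth_tens D U t -> smooth_tens D U t' ->
  degle k U t -> degle k U t' ->
  eq_on U (Phi (tadd t t')) (fun x => Phi t x + Phi t' x).
Proof.
move=> st st' dt dt' x Ux.
by rewrite -tadd_scale1 (tensorial_lin HPhi (csmooth_cst U 1) st st' dt dt' Ux) scale1r.
Qed.

Lemma tensorial_zero : eq_on U (Phi (fun _ _ => 0)) (fun=> 0).
Proof.
move=> x Ux; have s0 := smooth_tens0 D U.
have d0 : degle k U ((fun _ _ => 0) : tfield) by [].
have := tensorial_add s0 s0 d0 d0 Ux; set z := tadd _ _.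
have -> : z = (fun _ _ => 0) by apply/funext => y; apply/funext => w; rewrite /z /tadd addr0.
by move/eqP; rewrite -subr_eq0 opprD addrA subrr sub0r oppr_eq0 => /eqP.
Qed.

Lemma tensorial_scale f t : csmooth_fun U f -> smooth_tens D U t -> degle k U t ->
  eq_on U (Phi (tscale f t)) (fun x => f x *: Phi t x).
Proof.
move=> sf st dt x Ux; rewrite -tscale_add0.
have d0 : degle k U ((fun _ _ => 0) : tfield) by [].
by rewrite (tensorial_lin HPhi sf st (smooth_tens0 D U) dt d0 Ux) tensorial_zero// addr0.
Qed.

Lemma tensorial_tsum (I : Type) (s : seq I) (t : I -> tfield) :
  (forall l, smooth_tens D U (t l)) -> (forall l, degle k U (t l)) ->
  eq_on U (Phi (tsum s t)) (fun x => \sum_(l <- s) Phi (t l) x).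
Proof.
move=> st dt x Ux; elim: s => [|a s IH] /=; first by rewrite big_nil tensorial_zero.
by rewrite (tensorial_add (st a) (smooth_tsum s oU st) (dt a) (degle_tsum s dt) Ux) IH big_cons.
Qed.

Lemma tensorial_tmul p q (u : tfield) : smooth_tens D U u -> degle p U u ->
  (p + q <= k)%N -> tensorial q U (fun t => Phi (tmul u t)).
Proof.
move=> su du pqk.
have dut t : degle q U t -> degle k U (tmul u t).
  by move=> dt; apply: degle_leq pqk _; exact: degle_tmul.
have sut t : smooth_tens D U t -> smooth_tens D U (tmul u t) by exact: smooth_tmul.
split=> [t t' st st' dt dt' tt|f t t' sf st st' dt dt'].
  apply: (tensorial_ext HPhi); [exact: sut|exact: sut|exact: dut|exact: dut|].
  by move=> x Ux; apply: tmul_ext => //; exact: tt.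
have -> : tmul u (tadd (tscale f t) t') = tadd (tscale f (tmul u t)) (tmul u t').
  by apply/funext => x; apply/funext => w; rewrite tmul_lin_r.
by apply: (tensorial_lin HPhi) => //; [exact: sut|exact: sut|exact: dut|exact: dut].
Qed.

End Tensorial.

(* [t] itself is a combination of products of local fields only; multiplying it
   by the square of a cutoff makes all the factors global. *)
Lemma tensorial_unique k U Phi1 Phi2 : open U ->
  tensorial k U Phi1 -> tensorial k U Phi2 ->
  (forall Zs, all_smooth D U Zs -> (size Zs <= k)%N ->
     eq_on U (Phi1 (tprod Zs)) (Phi2 (tprod Zs))) ->
  forall t, smooth_tens D U t -> degle k U t -> eq_on U (Phi1 t) (Phi2 t).
Proof.
move=> oU; elim: k Phi1 Phi2 => [|k IH] Phi1 Phi2 H1 H2 H12 t st dt x Ux.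
  have s0 := smooth_tens_nil st; have sf := smooth_tfun D s0.
  have d1 : degle 0 U (tone : tfield) by exact: degle_tfun.
  have df : degle 0 U (tfun (fun y => t y [::]) : tfield) by exact: degle_tfun.
  have s1 : smooth_tens D U (tone : tfield) by apply/smooth_tfun/csmooth_cst.
  rewrite (tensorial_ext H1 st sf dt df (degle0 dt) Ux).
  rewrite (tensorial_ext H2 st sf dt df (degle0 dt) Ux) tfun_scale.
  by rewrite (tensorial_scale H1)// (tensorial_scale H2)// (H12 [::]).
(* The induction hypothesis is applied to [Y |-> Phi (tmul (tvec Z) Y)]; on products of vector
   fields this is the assumption for one factor more. *)
have Hmul Z Y : csmooth_BF D U Z -> smooth_tens D U Y -> degle k U Y ->
    eq_on U (Phi1 (tmul (tvec Z) Y)) (Phi2 (tmul (tvec Z) Y)).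
  move=> sZ; have sz := smooth_tvec oU sZ; have dz : degle 1 U (tvec Z) by exact: degle_tvec.
  apply: (IH (fun t => Phi1 (tmul (tvec Z) t)) (fun t => Phi2 (tmul (tvec Z) t)));
    [exact: (tensorial_tmul oU H1 sz dz)|exact: (tensorial_tmul oU H2 sz dz)|].
  by move=> Zs sZs kZs; apply: (H12 (Z :: Zs)).
pose i := bat (gEB D) x; pose j := bat (gEF D) x; pose V := fdom i j.
have Vx : V x by split; exact: batP.
have oV : open V by exact: fdom_open.
have [chi0 [W [sc0 c1 oW VW cW0]]] := bump_function oV Vx.
pose chi y : C := real_complex R (chi0 y).
have sc : csmooth_fun U chi by apply: csmooth_fun_restrict (csmooth_real sc0).
have scc := csmooth_mul oU sc sc.
have cW y : W y -> chi y = 0 by move=> Wy; rewrite /chi cW0.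
pose a y := chi y * chi y * t y [::].
pose u l := tmul (tvec (fun y => chi y *: BFframe i j l y)) (tscale chi (contr i j l t)).
(* On [V] this is the frame decomposition, with one [chi] given to the frame vector and one to the
   contraction; on [W] both sides vanish. *)
have E : eq_on U (tscale (fun y => chi y * chi y) t)
                 (tadd (tfun a) (tsum (index_enum 'I_(r + r)) u)).
  move=> y Uy; apply/funext => w; rewrite /tadd tsumE.
  have [[iy jy]|Wy] := VW y.
    rewrite /tscale (tens_decomp t w iy jy) mulrDr; congr (_ + _).
      by case: w => [|b w] //=; rewrite mulr0.
    rewrite mulr_sumr; apply: eq_bigr => l _; rewrite /u !tmul_tvec.
    by case: w => [|b w]; rewrite ?mulr0// [X in _ = X * _]mxE /tscale; ring.
  rewrite /tscale cW// !mul0r big1 ?addr0.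
    by case: w => [|b w] //=; rewrite /a cW// !mul0r.
  by move=> l _; rewrite /u tmul_tvec; case: w => // b w; rewrite [X in X * _]mxE cW// !mul0r.
have sa : csmooth_fun U a by exact: csmooth_mul oU scc (smooth_tens_nil st).
have sF l : csmooth_BF D U (fun y => chi y *: BFframe i j l y).
  apply: (csmooth_BF_cutoff oU oV oW sc VW cW).
  apply: (csmooth_BF_restrict (U := V)) => [y []//|].
  exact: BFframe_smooth.
have sC l : smooth_tens D U (tscale chi (contr i j l t)).
  by apply: (smooth_tens_cutoff oU oV oW sc VW cW); exact: smooth_contr.
have dC l : degle k U (tscale chi (contr i j l t)).
  by move=> y w Uy kw; rewrite /tscale (degle_contr i j l dt)// mulr0.
have su l : smooth_tens D U (u l) by apply: smooth_tmul => //; exact: smooth_tvec.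
have du l : degle k.+1 U (u l).
  by rewrite -add1n; apply: degle_tmul => //; exact: degle_tvec.
have stf := smooth_tfun D sa; have sts := smooth_tsum (index_enum 'I_(r + r)) oU su.
have dtf : degle k.+1 U (tfun a : tfield) by exact: degle_tfun.
have dts := degle_tsum (index_enum 'I_(r + r)) du.
have val Phi : tensorial k.+1 U Phi ->
    Phi t x = a x *: Phi tone x + \sum_l Phi (u l) x.
  move=> H; have -> : Phi t x = Phi (tscale (fun y => chi y * chi y) t) x.
    by rewrite (tensorial_scale H)// /chi c1 mul1r scale1r.
  rewrite (tensorial_ext H _ _ _ _ E Ux).
  - rewrite (tensorial_add H stf sts dtf dts Ux) (tensorial_tsum oU H _ su du Ux) tfun_scale.
    rewrite (tensorial_scale H)//; last exact: degle_tfun.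
    by apply/smooth_tfun/csmooth_cst.
  - exact: smooth_tscale.
  - exact: smooth_tadd.
  - by move=> y w Uy kw; rewrite /tscale dt// mulr0.
  - by move=> y w Uy kw; rewrite /tadd dtf// dts// addr0.
rewrite (val _ H1) (val _ H2) (H12 [::])//; congr (_ + _).
by apply: eq_bigr => l _; exact: Hmul.
Qed.

End Uniqueness.

(** * Existence and module structure *)

Lemma eq_double0 (V : zmodType) (a : V) : a = a + a -> a = 0.
Proof. by move/eqP; rewrite -subr_eq0 opprD addrA subrr sub0r oppr_eq0 => /eqP. Qed.

(** Here [c *: p] stands for the derivative of the coefficient times the value on [t], which [A_op]
    and [nabT] both produce. *)
Lemma scale_shuffle (K : pzRingType) (V : lmodType K) (c f : K) (p a a' b b' : V) :
  c *: p + f *: a + a' - (c *: p + (f *: b + b')) = f *: (a - b) + (a' - b').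
Proof.
by rewrite -(addrA (c *: p)) (opprD (c *: p)) addrACA subrr add0r opprD addrACA scalerBr.
Qed.

(** * Actions of bounded degree and their construction along a frame *)

Section Recursive_action.
Context {R : realType} {n r m : nat} {M : manifold R n}.
Context (D : geometric_data (M := M) r) (Sp : spinor_data D m).
Local Notation C := R[i].
Local Notation tfield := (@tfield R n M r).
Context (nabT : csec r -> tfield -> tfield) (hT : tensor_connection D nabT).
Implicit Types (U V W : set M) (t u Y : tfield) (f : M -> C).
Implicit Types (s : @csec R n M m) (Phi : tfield -> @csec R n M m).
Implicit Types (i : bI (gEB D)) (j : bI (gEF D)) (Z : @csec R n M (r + r)).

(** The recursion is required only for [Y] of degree below [k], so that the product stays within
    degree [k]; truncations of finite depth can then satisfy it. *)
Record recursive (k : nat) U s Phi : Prop := Recursive {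
  recursive_tensorial : tensorial D k U Phi;
  recursive_smooth : forall t, smooth_tens D U t -> degle k U t -> csmooth_spinor Sp U (Phi t);
  recursive_fun : forall f, csmooth_fun U f -> eq_on U (Phi (tfun f)) (fun x => f x *: s x);
  recursive_rec : forall Z Y, csmooth_BF D U Z -> smooth_tens D U Y ->
    (forall l, (l < k)%N -> degle l U Y -> eq_on U (Phi (tmul (tvec Z) Y))
      (fun x => A_op Sp Z (Phi Y) x - Phi (nabT (prB Z) Y) x)) }.

Lemma recursive_leq k k' U s Phi : (k <= k')%N ->
  recursive k' U s Phi -> recursive k U s Phi.
Proof.
move=> kk [rt rs rf rr]; split => //; first exact: tensorial_leq rt.
  by move=> t st dt; apply: rs => //; exact: degle_leq dt.
by move=> Z Y sZ sY l lk; apply: rr => //; exact: leq_trans kk.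
Qed.

Lemma recursive_tprod k U s Phi : open U -> recursive k U s Phi ->
  forall Zs, all_smooth D U Zs -> (size Zs <= k)%N ->
  eq_on U (Phi (tprod Zs)) (A_pow Sp Zs s).
Proof.
(* The derivative term replaces an entry of the tail, giving a list that is not a tail but has the
   same length; hence induction on a bound for the length. *)
move=> oU H Zs; have [l] : exists l, (size Zs <= l)%N by exists (size Zs).
elim: l Zs => [|l IH] [|Z Zs]//=.
- by move=> _ _ _ x Ux; have := recursive_fun H (csmooth_cst U 1) Ux; rewrite scale1r.
- by move=> _ _ _ x Ux; have := recursive_fun H (csmooth_cst U 1) Ux; rewrite scale1r.
rewrite ltnS => Zsl [sZ sZs] Zsk x Ux.
have sP := smooth_tprod oU sZs; have dP : degle (size Zs) U (tprod Zs) by exact: degle_tprod.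
have dP' := degle_leq (ltnW Zsk) dP.
rewrite (recursive_rec H sZ sP Zsk dP Ux) /A_pow /=.
have E := IH _ Zsl sZs (ltnW Zsk).
have sPhi := recursive_smooth H sP dP'.
have sA := csmooth_sec_ext (@sp_open _ _ _ _ _ _ Sp) oU E sPhi.
rewrite (A_op_ext oU sZ sZ sPhi sA (fun _ _ => erefl) E Ux); congr (_ - _).
have [sB _] := sZ.
have sm (j : 'I_(size Zs)) :
    all_smooth D U (set_nth Z Zs j (nabBF D (prB Z) (nth Z Zs j))).
  by apply: all_smooth_set_nth => //; apply: nabBF_smooth => //; exact: all_smooth_nth.
have sz (j : 'I_(size Zs)) v : size (set_nth Z Zs j v) = size Zs.
  by rewrite size_set_nth; apply/maxn_idPr.
have dm (j : 'I_(size Zs)) :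
    degle k U (tprod (set_nth Z Zs j (nabBF D (prB Z) (nth Z Zs j)))).
  set Zs' := set_nth _ _ _ _.
  have d' : degle (size Zs') U (tprod Zs') by exact: degle_tprod.
  by apply: (degle_leq _ d'); rewrite sz ltnW.
have smt (j : 'I_(size Zs)) := smooth_tprod oU (sm j).
rewrite (tensorial_ext (recursive_tensorial H) _ _ _ _ (nabT_tprod hT Z oU sB sZs) Ux);
  last first.
- exact: degle_tsum.
- by apply: (degle_nabT hT).
- exact: smooth_tsum.
- exact: (tc_smooth hT).
rewrite (tensorial_tsum oU (recursive_tensorial H) _ smt dm Ux); apply: eq_bigr => j _.
have smj := sm j; move: (sz j (nabBF D (prB Z) (nth Z Zs j))).
move: (set_nth _ _ _ _) smj => Zs' smj szj.
have szl : (size Zs' <= l)%N by rewrite szj.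
have szk : (size Zs' <= k)%N by rewrite szj ltnW.
by rewrite (IH _ szl smj szk x Ux) /A_pow szj.
Qed.

Lemma recursive_unique k U s s' Phi Phi' : open U -> eq_on U s s' ->
  csmooth_spinor Sp U s -> csmooth_spinor Sp U s' ->
  recursive k U s Phi -> recursive k U s' Phi' ->
  forall t, smooth_tens D U t -> degle k U t -> eq_on U (Phi t) (Phi' t).
Proof.
move=> oU ss sms sms' H H'.
have H1 : recursive k U s Phi'.
  case: H' => rt rs rf rr; split => // f sf x Ux.
  by rewrite (rf f sf x Ux) ss.
apply: (tensorial_unique oU (recursive_tensorial H) (recursive_tensorial H1))
  => Zs sZs Zsk x Ux.
by rewrite (recursive_tprod oU H sZs Zsk Ux) (recursive_tprod oU H1 sZs Zsk Ux).
Qed.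

(** The value forced by the frame decomposition of [t] and the recursion for frame vectors. The
    number [k] limits the depth, since the tensors met on the way are not subterms; from the degree
    of [t] on, the value no longer depends on it. *)
Fixpoint local_action i j k t s : @csec R n M m :=
  match k with
  | 0 => fun x => t x [::] *: s x
  | k'.+1 => fun x => t x [::] *: s x +
      \sum_l (A_op Sp (BFframe i j l) (local_action i j k' (contr i j l t) s) x
        - local_action i j k' (nabT (prB (BFframe i j l)) (contr i j l t)) s x)
  end.

Section Local_action.
Variables (i : bI (gEB D)) (j : bI (gEF D)) (V : set M) (s : @csec R n M m).
Hypotheses (oV : open V) (Vf : V `<=` fdom i j) (ss : csmooth_spinor Sp V s).
Local Notation F := (BFframe i j).
Local Notation Psi k t := (local_action i j k t s).
Let oS := @sp_open _ _ _ _ _ _ Sp.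

Let sF l : csmooth_BF D V (F l).
Proof. by apply: csmooth_BF_restrict Vf _; exact: BFframe_smooth. Qed.

Let sFB l : csmooth_sec (gEB D) V (prB (F l)) := (sF l).1.

Let sc l t : smooth_tens D V t -> smooth_tens D V (contr i j l t).
Proof. exact: smooth_contr_sub. Qed.

Let sn l t : smooth_tens D V t -> smooth_tens D V (nabT (prB (F l)) t).
Proof. exact: (tc_smooth hT). Qed.

Lemma local_action_smooth k t : smooth_tens D V t -> csmooth_spinor Sp V (Psi k t).
Proof.
elim: k t => [|k IH] t st /=.
  exact: (csmooth_sec_scale oS oV (smooth_tens_nil st) ss).
apply: csmooth_sec_add => //.
  exact: (csmooth_sec_scale oS oV (smooth_tens_nil st) ss).
apply: csmooth_sec_sum => // l; apply: csmooth_sec_add => //.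
  by apply: A_op_smooth => //; apply: IH; exact: sc.
by apply: csmooth_sec_opp => //; apply: IH; apply: sn; exact: sc.
Qed.

Lemma local_action_ext k t t' : smooth_tens D V t -> smooth_tens D V t' ->
  eq_on V t t' -> eq_on V (Psi k t) (Psi k t').
Proof.
elim: k t t' => [|k IH] t t' st st' tt x Vx /=; rewrite tt//.
congr (_ + _); apply: eq_bigr => l _.
have E : eq_on V (contr i j l t) (contr i j l t').
  by move=> y Vy; apply/funext => w; rewrite /contr tt.
have En := tc_local hT oV (sFB l) (sFB l) (sc l st) (sc l st') (fun _ _ => erefl) E.
rewrite (IH _ _ (sn l (sc l st)) (sn l (sc l st')) En x Vx); congr (_ - _).
apply: (A_op_ext oV (sF l) (sF l)) => //; first exact/local_action_smooth/sc.
  exact/local_action_smooth/sc.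
exact: IH (sc l st) (sc l st') E.
Qed.

Definition step k l t : @csec R n M m := fun x =>
  A_op Sp (F l) (Psi k t) x - Psi k (nabT (prB (F l)) t) x.

(** Linearity at depth [k] is taken as a hypothesis because the lemma serves inside the induction
    that proves [local_action_lin]. *)
Lemma step_lin k l f t t' :
  (forall f t t', csmooth_fun V f -> smooth_tens D V t -> smooth_tens D V t' ->
    eq_on V (Psi k (tadd (tscale f t) t')) (fun x => f x *: Psi k t x + Psi k t' x)) ->
  csmooth_fun V f -> smooth_tens D V t -> smooth_tens D V t' ->
  eq_on V (step k l (tadd (tscale f t) t')) (fun x => f x *: step k l t x + step k l t' x).
Proof.
move=> lin sf st st' x Vx.
have snt := sn l st; have snt' := sn l st'.
have slin := smooth_tens_lin oV sf st st'.
have sact := cact_smooth hT oV (sFB l) sf.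
have snlin := smooth_tens_lin oV sf snt snt'.
have sP := @local_action_smooth k.
have sP1 := csmooth_sec_lin oS oV sf (sP _ st) (sP _ st').
rewrite /step (A_op_ext oV (sF l) (sF l) (sP _ slin) sP1 (fun _ _ => erefl)
  (lin _ _ _ sf st st') Vx).
rewrite (A_op_leibniz oV sf (sF l) (sP _ st) (sP _ st') Vx).
have sn3 := smooth_tens_lin oV sact st snlin.
have E := nabT_lin hT oV (sFB l) sf st st'.
rewrite (local_action_ext k (sn l slin) sn3 E Vx).
rewrite (lin _ _ _ sact st snlin x Vx) (lin _ _ _ sf snt snt' x Vx).
exact: scale_shuffle.
Qed.

Lemma contr_linE l f t t' :
  contr i j l (tadd (tscale f t) t') = tadd (tscale f (contr i j l t)) (contr i j l t').
Proof. by apply/funext => y; apply/funext => w; rewrite contr_lin. Qed.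

Lemma local_action_lin k f t t' : csmooth_fun V f ->
  smooth_tens D V t -> smooth_tens D V t' ->
  eq_on V (Psi k (tadd (tscale f t) t')) (fun x => f x *: Psi k t x + Psi k t' x).
Proof.
elim: k f t t' => [|k IH] f t t' sf st st' x Vx /=.
  by rewrite /tadd /tscale scalerDl scalerA.
rewrite {1}/tadd {1}/tscale scalerDr [X in _ = X]addrACA scalerDl scalerA.
congr (_ + _); rewrite scaler_sumr -big_split; apply: eq_bigr => l _ /=.
rewrite contr_linE; exact: (step_lin l IH sf (sc l st) (sc l st') Vx).
Qed.

Lemma local_action_tensorial d k : tensorial D d V (fun t => Psi k t).
Proof.
split=> [t t' st st' _ _ tt|f t t' sf st st' _ _]; first exact: local_action_ext.
exact: local_action_lin.
Qed.

Lemma A_op_zero Z : csmooth_BF D V Z -> eq_on V (A_op Sp Z (fun=> 0)) (fun=> 0).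
Proof.
move=> sZ x Vx; have s0 := csmooth_sec0 (sp_bundle Sp) V.
have := A_op_leibniz oV (csmooth_cst V 1) sZ s0 s0 Vx.
have z0 : (fun x : M => (1 : C) *: (0 : 'cV[C]_m) + 0) = (fun=> 0).
  by apply/funext => y; rewrite scaler0 addr0.
by rewrite [X in A_op _ _ X _]z0 cact_cst scale0r add0r scale1r; exact: eq_double0.
Qed.

(** Each level contracts once, and [nabT] does not raise the degree; after [k] levels only
    contractions of degree zero tensors remain, and these vanish. *)
Lemma local_action_stable k t : smooth_tens D V t -> degle k V t ->
  eq_on V (Psi k.+1 t) (Psi k t).
Proof.
elim: k t => [|k IH] t st dt x Vx.
  rewrite /= big1 ?addr0// => l _.
  have c0 : eq_on V (contr i j l t) (fun _ _ => 0).
    by move=> y Vy; apply/funext => w; rewrite /contr big1// => a _; rewrite dt ?mulr0.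
  have z0 : eq_on V (fun y => contr i j l t y [::] *: s y) (fun=> 0).
    by move=> y Vy; rewrite c0// scale0r.
  have sz := local_action_smooth 0 (sc l st).
  rewrite (A_op_ext oV (sF l) (sF l) sz (csmooth_sec0 _ V) (fun _ _ => erefl) z0 Vx).
  rewrite (A_op_zero (sF l) Vx) sub0r.
  have n0 : eq_on V (nabT (prB (F l)) (contr i j l t)) (fun _ _ => 0).
    move=> y Vy; rewrite (tc_local hT oV (sFB l) (sFB l) (sc l st) (smooth_tens0 D V)
      _ c0 Vy)//.
    exact: (nabT0 hT oV (sFB l) Vy).
  by rewrite n0// scale0r oppr0.
rewrite [LHS]/= [RHS]/=; congr (_ + _); apply: eq_bigr => l _.
have dc := degle_contr i j l dt.
have dn := degle_nabT hT oV (sFB l) (sc l st) dc.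
rewrite -[in RHS](IH _ (sn l (sc l st)) dn x Vx); congr (_ - _).
have sP q := local_action_smooth q (sc l st).
exact: (A_op_ext oV (sF l) (sF l) (sP k.+1) (sP k) (fun _ _ => erefl) (IH _ (sc l st) dc) Vx).
Qed.

Lemma local_action_stable_leq d k t : (d <= k)%N -> smooth_tens D V t -> degle d V t ->
  eq_on V (Psi k t) (Psi d t).
Proof.
move=> dk st dt x Vx; elim: k dk => [|k IH]; first by rewrite leqn0 => /eqP ->.
rewrite leq_eqVlt => /predU1P[->//|]; rewrite ltnS => dk.
by rewrite (local_action_stable st (degle_leq dk dt) Vx) IH.
Qed.

Section Direction.
Variables (k : nat) (Y : tfield).
Hypothesis sY : smooth_tens D V Y.

Let dir Z : @csec R n M m := fun x =>
  A_op Sp Z (Psi k Y) x - Psi k (nabT (prB Z) Y) x.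

Let dir_ext Z Z' : csmooth_BF D V Z -> csmooth_BF D V Z' -> eq_on V Z Z' ->
  eq_on V (dir Z) (dir Z').
Proof.
move=> sZ sZ' ZZ x Vx; have sP := local_action_smooth k sY.
rewrite /dir (A_op_ext oV sZ sZ' sP sP ZZ (fun _ _ => erefl) Vx); congr (_ - _).
have [sB _] := sZ; have [sB' _] := sZ'.
apply: local_action_ext Vx; [exact: (tc_smooth hT)|exact: (tc_smooth hT)|].
by apply: (tc_local hT) => // y Vy; rewrite /prB ZZ.
Qed.

Let dir_lin f Z Z' : csmooth_fun V f -> csmooth_BF D V Z -> csmooth_BF D V Z' ->
  eq_on V (dir (fun x => f x *: Z x + Z' x)) (fun x => f x *: dir Z x + dir Z' x).
Proof.
move=> sf sZ sZ' x Vx; have sP := local_action_smooth k sY.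
rewrite /dir (A_op_linl oV sf sZ sZ' sP Vx).
have [sB _] := sZ; have [sB' _] := sZ'; have [sB'' _] := csmooth_BF_lin oV sf sZ sZ'.
have sn1 := tc_smooth hT oV sB sY; have sn2 := tc_smooth hT oV sB' sY.
have -> : Psi k (nabT (prB (fun x => f x *: Z x + Z' x)) Y) x =
    f x *: Psi k (nabT (prB Z) Y) x + Psi k (nabT (prB Z') Y) x.
  rewrite -(local_action_lin k sf sn1 sn2 Vx).
  apply: local_action_ext Vx; [exact: (tc_smooth hT)|exact: smooth_tens_lin|].
  by rewrite (prBF_lin f Z Z').1; exact: (tc_linearl hT).
by rewrite scalerBr opprD addrACA.
Qed.

(** Only frame directions occur in [local_action]. The left side is linear over functions in [Z],
    since both [A_op] and [nabT] are, so it may be expanded in the frame. *)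
Lemma local_action_direction Z : csmooth_BF D V Z -> eq_on V
  (fun x => A_op Sp Z (Psi k Y) x - Psi k (nabT (prB Z) Y) x)
  (fun x => \sum_l (cBFinv i j x *m Z x) l ord0 *: step k l Y x).
Proof.
move=> sZ; pose z l x := (cBFinv i j x *m Z x) l ord0.
(* Partial sums of the frame expansion of [Z], nested in the shape to which [dir_lin] applies. *)
pose W (q : seq 'I_(r + r)) : @csec R n M (r + r) :=
  foldr (fun l (acc : @csec R n M (r + r)) => fun x => z l x *: F l x + acc x) (fun=> 0) q.
have sz l : csmooth_fun V (z l).
  by have := BFcoef_smooth i j l oV sZ; rewrite setIidl.
have s0 : csmooth_BF D V (fun=> 0).
  split; [rewrite (_ : prB _ = fun=> 0)|rewrite (_ : prF _ = fun=> 0)];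
    try exact: csmooth_sec0; by apply/funext => y; rewrite /prB /prF linear0.
have d0 : eq_on V (dir (fun=> 0)) (fun=> 0).
  move=> x Vx; have := dir_lin (csmooth_cst V 1) s0 s0 Vx.
  have z0 : (fun x : M => (1 : C) *: (0 : 'cV[C]_(r + r)) + 0) = (fun=> 0).
    by apply/funext => y; rewrite scaler0 addr0.
  by rewrite [X in dir X _]z0 scale1r; exact: eq_double0.
have sW q : csmooth_BF D V (W q).
  by elim: q => [|l q IH] //=; exact: csmooth_BF_lin.
have WE q x : W q x = \sum_(l <- q) z l x *: F l x.
  by elim: q => [|l q IH]; rewrite ?big_nil ?big_cons//= IH.
have dW q x : V x -> dir (W q) x = \sum_(l <- q) z l x *: step k l Y x.
  move=> Vx; elim: q => [|l q IH]; first by rewrite big_nil d0.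
  by rewrite big_cons -IH; exact: dir_lin.
move=> x Vx; rewrite -[LHS]/(dir Z x) -dW//; apply: dir_ext Vx => //.
by move=> y /Vf[iy jy]; rewrite WE; exact: vec_decomp.
Qed.

End Direction.

(** Contracting [tmul (tvec Z) Y] returns [Y] times a component of [Z]. Linearity of [step] pulls
    the components out, and [local_action_direction] reassembles the direction [Z]; stability
    absorbs the difference of one in depth. *)
Lemma local_action_recursive k : recursive k V s (fun t => Psi k t).
Proof.
split; first exact: local_action_tensorial.
- by move=> t st _; exact: local_action_smooth.
- move=> f sf x Vx; have d0 : degle 0 V (tfun f : tfield) by exact: degle_tfun.
  exact: (local_action_stable_leq (leq0n k) (smooth_tfun D sf) d0 Vx).
move=> Z Y sZ sY l; case: k => [//|k]; rewrite ltnS => lk dY x Vx.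
have dkY := degle_leq lk dY; have [sB _] := sZ.
have sP := local_action_smooth k sY; have sP' := local_action_smooth k.+1 sY.
have E := local_action_stable sY dkY.
rewrite (A_op_ext oV sZ sZ sP' sP (fun _ _ => erefl) E Vx).
rewrite (local_action_stable (tc_smooth hT oV sB sY) (degle_nabT hT oV sB sY dkY) Vx).
rewrite (local_action_direction k sY sZ Vx) [LHS]/= tmul_nil mul0r scale0r add0r.
apply: eq_bigr => a _; pose z x := (cBFinv i j x *m Z x) a ord0.
have sz : csmooth_fun V z by have := BFcoef_smooth i j a oV sZ; rewrite setIidl.
have -> : contr i j a (tmul (tvec Z) Y) = tscale z Y.
  by apply/funext => y; apply/funext => w; rewrite contr_tvec.
have H := step_lin a (@local_action_lin k) sz sY (smooth_tens0 D V) Vx.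
rewrite tscale_add0 in H; rewrite -[LHS]/(step k a (tscale z Y) x) H.
suff -> : step k a (fun _ _ => 0) x = 0 by rewrite addr0.
have H0 := step_lin a (@local_action_lin k) (csmooth_cst V 1)
  (smooth_tens0 D V) (smooth_tens0 D V) Vx.
move: H0; rewrite tadd_scale1 scale1r.
have -> : tadd (fun _ _ => 0) (fun _ _ => 0) = (fun _ _ => 0) :> tfield.
  by apply/funext => y; apply/funext => w; rewrite /tadd addr0.
exact: eq_double0.
Qed.

End Local_action.
End Recursive_action.

(** * Gluing, equivalence of the two definitions, module structure *)

Section Global_action.
Context {R : realType} {n r m : nat} {M : manifold R n}.
Context (D : geometric_data (M := M) r) (Sp : spinor_data D m).
Local Notation C := R[i].
Local Notation tfield := (@tfield R n M r).
Context (nabT : csec r -> tfield -> tfield) (hT : tensor_connection D nabT).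
Implicit Types (U V W : set M) (t u Y : tfield) (f : M -> C).
Implicit Types (s : @csec R n M m) (Z : @csec R n M (r + r)).
Local Notation recursive := (recursive Sp nabT).
Local Notation local_action := (local_action Sp nabT).
Local Notation ib x := (bat (gEB D) x).
Local Notation jb x := (bat (gEF D) x).
Local Notation nbd U x := (U `&` fdom (ib x) (jb x)).

Lemma nbd_open U x : open U -> open (nbd U x).
Proof. by move=> oU; apply: openI => //; exact: fdom_open. Qed.

Lemma nbd_in U x : U x -> nbd U x x.
Proof. by move=> Ux; split => //; split; exact: batP. Qed.

(** A chosen degree bound, not necessarily the least; for smooth tensors stability makes the choice
    harmless. The default 0 is returned only when there is no bound. *)
Definition tdegree U t : nat := xget 0%N [set d | degle d U t].

Lemma degle_tdegree U t : smooth_tens D U t -> degle (tdegree U t) U t.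
Proof. by move=> [H _]; exact: (xgetPex 0%N H). Qed.

Definition glued_action U t s : @csec R n M m :=
  fun x => local_action (ib x) (jb x) (tdegree U t) t s x.

(** At [y] the left side uses the frame preferred at [y], the right side the one preferred at [x].
    Uniqueness on the common domain identifies them; their depths may differ, so they are compared
    at the smaller one, which still bounds the degree of [t]. *)
Lemma glued_action_local U s s' t k x : open U -> eq_on U s s' ->
  csmooth_spinor Sp U s -> csmooth_spinor Sp U s' -> smooth_tens D U t ->
  degle k U t -> U x ->
  eq_on (nbd U x) (glued_action U t s) (local_action (ib x) (jb x) k t s').
Proof.
move=> oU ss sms sms' st dt Ux y [Uy xy].
pose V := nbd U x `&` fdom (ib y) (jb y).
have VU : V `<=` U by move=> z [[]].
have oV : open V by apply: openI; [exact: nbd_open|exact: fdom_open].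
have Vy : V y by split; [split|split; exact: batP].
have Vfx : V `<=` fdom (ib x) (jb x) by move=> z [[]].
have Vfy : V `<=` fdom (ib y) (jb y) by move=> z [].
have smV := csmooth_sec_restrict VU sms; have smV' := csmooth_sec_restrict VU sms'.
have ssV : eq_on V s s' by move=> z /VU; exact: ss.
pose d := minn (tdegree U t) k.
have Hy := recursive_leq (geq_minl _ k) (local_action_recursive hT oV Vfy smV (tdegree U t)).
have Hx := recursive_leq (geq_minr (tdegree U t) _) (local_action_recursive hT oV Vfx smV' k).
apply: (recursive_unique hT oV ssV smV smV' Hy Hx _ _ Vy).
  exact: smooth_tens_restrict VU st.
apply: (degle_restrict VU); case: (leqP (tdegree U t) k) => _ //.
exact: degle_tdegree.
Qed.

Lemma glued_action_recursive k U s : open U -> csmooth_spinor Sp U s ->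
  recursive k U s (fun t => glued_action U t s).
Proof.
move=> oU sms.
have loc t d x : smooth_tens D U t -> degle d U t -> U x ->
    eq_on (nbd U x) (glued_action U t s) (local_action (ib x) (jb x) d t s).
  by move=> st dt Ux; exact: glued_action_local.
have sub x : nbd U x `<=` U by move=> y [].
have subf x : nbd U x `<=` fdom (ib x) (jb x) by move=> y [].
have smV x := csmooth_sec_restrict (sub x) sms.
have H d x := local_action_recursive hT (nbd_open x oU) (subf x) (smV x) d.
have res t x : smooth_tens D U t -> smooth_tens D (nbd U x) t by exact: smooth_tens_restrict.
have sm t : smooth_tens D U t -> csmooth_spinor Sp U (glued_action U t s).
  move=> st; apply: csmooth_sec_local => x Ux; exists (nbd U x); first exact: nbd_in.
  have dt := degle_tdegree st.
  have E y Vy := esym (loc _ _ x st dt Ux y Vy).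
  apply: (csmooth_sec_ext (@sp_open _ _ _ _ _ _ Sp) (nbd_open x oU) E).
  exact: (recursive_smooth (H _ x) (res _ x st) (degle_restrict (sub x) dt)).
split.
- split=> [t t' st st' dt dt' tt x Ux|f t t' sf st st' dt dt' x Ux].
    have Vx := nbd_in Ux; rewrite (loc _ _ _ st dt Ux _ Vx) (loc _ _ _ st' dt' Ux _ Vx).
    apply: (tensorial_ext (recursive_tensorial (H k x)) _ _ _ _ _ Vx);
      [exact: res|exact: res| | |].
    + exact: degle_restrict (sub x) dt.
    + exact: degle_restrict (sub x) dt'.
    + by move=> y [Uy _]; exact: tt.
  have Vx := nbd_in Ux; have dl : degle k U (tadd (tscale f t) t') by exact: degle_lin.
  rewrite (loc _ _ _ (smooth_tens_lin oU sf st st') dl Ux _ Vx).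
  rewrite (loc _ _ _ st dt Ux _ Vx) (loc _ _ _ st' dt' Ux _ Vx).
  apply: (tensorial_lin (recursive_tensorial (H k x)) _ _ _ _ _ Vx);
    [|exact: res|exact: res| |].
  + exact: csmooth_fun_restrict (sub x) sf.
  + exact: degle_restrict (sub x) dt.
  + exact: degle_restrict (sub x) dt'.
- by move=> t st _; exact: sm.
- move=> f sf x Ux; have d0 : degle 0 U (tfun f : tfield) by exact: degle_tfun.
  by rewrite (loc _ _ _ (smooth_tfun D sf) d0 Ux _ (nbd_in Ux)).
move=> Z Y sZ sY l _ dY x Ux; have Vx := nbd_in Ux.
have [sB _] := sZ.
have dZ : degle 1 U (tvec Z) by exact: degle_tvec.
have dZY : degle l.+1 U (tmul (tvec Z) Y) by rewrite -add1n; exact: degle_tmul.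
have dY' := degle_leq (leqnSn l) dY.
have sZY := smooth_tmul oU (smooth_tvec oU sZ) sY.
rewrite (loc _ _ _ sZY dZY Ux _ Vx).
have sZV := csmooth_BF_restrict (sub x) sZ.
rewrite (recursive_rec (H l.+1 x) sZV (res _ x sY) (ltnSn l) (degle_restrict (sub x) dY) Vx).
have sn := tc_smooth hT oU sB sY; have dn := degle_nabT hT oU sB sY dY'.
rewrite -(loc _ _ _ sn dn Ux _ Vx); congr (_ - _).
have sl := recursive_smooth (H l.+1 x) (res _ x sY) (degle_restrict (sub x) dY').
have sg := csmooth_sec_restrict (sub x) (sm _ sY).
apply: (A_op_ext (nbd_open x oU) sZV sZV sl sg (fun _ _ => erefl) _ Vx).
by move=> y Vy; rewrite (loc _ _ _ sY dY' Ux _ Vy).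
Qed.

Lemma glued_tensor_action U : open U -> tensor_action Sp U (glued_action U).
Proof.
move=> oU; split.
- move=> t s st sms.
  exact: (recursive_smooth (glued_action_recursive _ oU sms) st (degle_tdegree st)).
- move=> t t' s s' st st' sms sms' tt ss x Ux.
  have dt := degle_tdegree st; have dt' := degle_tdegree st'.
  have dm := degle_leq (leq_maxl _ (tdegree U t')) dt.
  have dm' := degle_leq (leq_maxr (tdegree U t) _) dt'.
  have H := glued_action_recursive (maxn (tdegree U t) (tdegree U t')) oU sms'.
  rewrite -(tensorial_ext (recursive_tensorial H) st st' dm dm' tt Ux).
  rewrite (glued_action_local oU ss sms sms' st dt Ux (nbd_in Ux)).
  by rewrite -(glued_action_local oU (fun _ _ => erefl) sms' sms' st dt Ux (nbd_in Ux)).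
- move=> f t t' s sf st st' sms.
  have dt := degle_leq (leq_maxl _ (tdegree U t')) (degle_tdegree st).
  have dt' := degle_leq (leq_maxr (tdegree U t) _) (degle_tdegree st').
  exact: (tensorial_lin (recursive_tensorial (glued_action_recursive _ oU sms))
    sf st st' dt dt').
- move=> f s sf sms; exact: (recursive_fun (glued_action_recursive 0 oU sms) sf).
Qed.

Lemma tensor_action_tensorial k U Phi s : tensor_action Sp U Phi ->
  csmooth_spinor Sp U s -> tensorial D k U (fun t => Phi t s).
Proof.
move=> [_ he hl _] sms; split.
  by move=> t t' st st' _ _ tt; exact: he.
by move=> f t t' sf st st' _ _; exact: hl.
Qed.

Lemma tmul_tone Z : tmul (tvec Z) tone = tvec Z.
Proof.
apply/funext => x; apply/funext => w; rewrite tmul_tvec.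
by case: w => [|a [|b w]] //=; rewrite ?mulr1 ?mulr0.
Qed.

Lemma smooth_tone U : smooth_tens D U tone.
Proof. exact/smooth_tfun/csmooth_cst. Qed.

Lemma recursive_is_Phi' U Phi : open U -> tensor_action Sp U Phi ->
  (forall k s, csmooth_spinor Sp U s -> recursive k U s (fun t => Phi t s)) ->
  is_Phi' Sp nabT U Phi.
Proof.
move=> oU hP hr; split => // [Z s sZ sms x Ux|Z k Y s sZ sY hY sms x Ux].
  have d1 : degle 0 U (tone : tfield) by exact: degle_tfun.
  have sg := recursive_smooth (hr 0 s sms) (smooth_tone U) d1.
  have E : eq_on U (Phi tone s) s.
    by move=> y Uy; have := ta_fun hP (csmooth_cst U 1) sms Uy; rewrite scale1r.
  (* The clause for a single vector field is the recursion with [Y = tone], whose covariant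
     derivative is zero. *)
  rewrite -(tmul_tone Z) (recursive_rec (hr 1 s sms) sZ (smooth_tone U) (ltnSn 0) d1 Ux).
  rewrite (A_op_ext oU sZ sZ sg sms (fun _ _ => erefl) E Ux).
  have [sB _] := sZ; have sn := tc_smooth hT oU sB (smooth_tone U).
  have n0 : eq_on U (nabT (prB Z) tone) (fun _ _ => 0).
    by move=> y Uy; rewrite (tc_fun hT oU sB (csmooth_cst U 1) Uy) cact_cst tfun0.
  rewrite (ta_ext hP sn (smooth_tens0 D U) sms sms n0 (fun _ _ => erefl) Ux).
  by rewrite (tensorial_zero (tensor_action_tensorial 0 hP sms) Ux) subr0.
have dY : degle k U Y by move=> y w Uy kw; apply: hY => //; rewrite gtn_eqF.
exact: (recursive_rec (hr k.+1 s sms) sZ sY (ltnSn k) dY Ux).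
Qed.

Definition trestrict (p : pred nat) t : tfield := fun x w => if p (size w) then t x w else 0.

(** A change of frame preserves the length of words, so truncating by degree truncates the frame
    coefficients in the same way. *)
Lemma smooth_trestrict p U t : open U -> smooth_tens D U t -> smooth_tens D U (trestrict p t).
Proof.
move=> oU [[d dt] st]; split.
  by exists d => x w Ux dw; rewrite /trestrict dt// if_same.
move=> i j w; have E x : tcoef i j (trestrict p t) x w =
    if p (size w) then tcoef i j t x w else 0.
  rewrite /tcoef /trestrict; under eq_bigr do rewrite size_tuple.
  by case: ifP => // _; rewrite big1// => u _; rewrite mulr0.
by rewrite (funext E); case: (p (size w)); [exact: st|exact: csmooth_cst].
Qed.

Lemma is_Phi'_recursive k U Phi s : open U -> is_Phi' Sp nabT U Phi ->
  csmooth_spinor Sp U s -> recursive k U s (fun t => Phi t s).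
Proof.
move=> oU [hP _ hr] sms; split.
- exact: tensor_action_tensorial.
- by move=> t st _; exact: (ta_smooth hP).
- by move=> f sf; exact: (ta_fun hP).
move=> Z Y sZ sY l _; elim: l Y sY => [|l IH] Y sY dY.
  apply: (hr Z 0%N) => // x w Ux; rewrite -lt0n => w0; exact: dY.
pose a := trestrict (fun q => q <= l)%N Y; pose b := trestrict (fun q => q == l.+1) Y.
have sa : smooth_tens D U a by exact: smooth_trestrict.
have sb : smooth_tens D U b by exact: smooth_trestrict.
have E : eq_on U Y (tadd a b).
  move=> x Ux; apply/funext => w; rewrite /tadd /a /b /trestrict.
  have [wl|wl|wl] := ltngtP (size w) l.+1.
  - by rewrite -ltnS wl addr0.
  - by rewrite dY// if_same addr0.
  - by rewrite wl ltnn add0r.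
have da : degle l U a by move=> x w Ux lw; rewrite /a /trestrict leqNgt lw.
have hb : homog l.+1 U b by move=> x w Ux /negPf lw; rewrite /b /trestrict lw.
have [sB _] := sZ; have sz := smooth_tvec oU sZ.
have sna := tc_smooth hT oU sB sa; have snb := tc_smooth hT oU sB sb.
have sab := smooth_tadd oU sa sb.
have addP u v : smooth_tens D U u -> smooth_tens D U v ->
    eq_on U (Phi (tadd u v) s) (fun x => Phi u s x + Phi v s x).
  move=> su sv x Ux; have := ta_linear hP (csmooth_cst U 1) su sv sms Ux.
  by rewrite tadd_scale1 scale1r.
have refl (v : @csec R n M m) : eq_on U v v by [].
move=> x Ux.
have -> : Phi (tmul (tvec Z) Y) s x = Phi (tadd (tmul (tvec Z) a) (tmul (tvec Z) b)) s x.
  apply: (ta_ext hP _ _ sms sms _ (refl s) Ux); first exact: smooth_tmul.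
    by apply: smooth_tadd => //; exact: smooth_tmul.
  move=> y Uy; rewrite (tmul_ext (erefl (tvec Z y)) (E y Uy)).
  apply/funext => w; rewrite -tadd_scale1 tmul_lin_r mul1r.
  by rewrite /tadd.
rewrite (addP _ _ (smooth_tmul oU sz sa) (smooth_tmul oU sz sb) x Ux).
rewrite (IH a sa da x Ux) (hr Z l.+1 b s sZ sb hb sms x Ux) -/(A_op Sp Z (Phi b s) x).
have -> : Phi (nabT (prB Z) Y) s x = Phi (nabT (prB Z) a) s x + Phi (nabT (prB Z) b) s x.
  rewrite -(addP _ _ sna snb x Ux).
  apply: (ta_ext hP _ _ sms sms _ (refl s) Ux); first exact: (tc_smooth hT).
    exact: smooth_tadd.
  move=> y Uy; rewrite (tc_local hT oU sB sB sY sab (fun _ _ => erefl) E Uy).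
  exact: (tc_addr hT oU sB sa sb Uy).
have sPa := ta_smooth hP sa sms; have sPb := ta_smooth hP sb sms.
have sPY := ta_smooth hP sY sms.
have oS := @sp_open _ _ _ _ _ _ Sp.
have EP : eq_on U (Phi Y s) (fun y => 1 *: Phi a s y + Phi b s y).
  move=> y Uy; rewrite scale1r -(addP _ _ sa sb y Uy).
  exact: (ta_ext hP sY sab sms sms E (refl s) Uy).
have sP1 := csmooth_sec_lin oS oU (csmooth_cst U 1) sPa sPb.
rewrite (A_op_ext oU sZ sZ sPY sP1 (fun _ _ => erefl) EP Ux).
rewrite (A_op_leibniz oU (csmooth_cst U 1) sZ sPa sPb Ux).
by rewrite cact_cst scale0r add0r scale1r opprD addrACA.
Qed.

Lemma is_Phi'_is_Phi U Phi : open U -> is_Phi' Sp nabT U Phi -> is_Phi Sp U Phi.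
Proof.
move=> oU H; split; first by case: H.
move=> Zs s sZs sms.
exact: (recursive_tprod hT oU (is_Phi'_recursive (size Zs) oU H sms) sZs (leqnn _)).
Qed.

Lemma is_Phi_unique U Phi Phi' t s : open U -> is_Phi Sp U Phi -> is_Phi Sp U Phi' ->
  smooth_tens D U t -> csmooth_spinor Sp U s -> eq_on U (Phi t s) (Phi' t s).
Proof.
move=> oU [hP hZ] [hP' hZ'] st sms; have dt := degle_tdegree st.
apply: (tensorial_unique oU (tensor_action_tensorial _ hP sms)
  (tensor_action_tensorial _ hP' sms) _ st dt) => Zs sZs _ x Ux.
by rewrite hZ// hZ'.
Qed.

(** A general [Y] need not be a combination of products visible to [is_Phi] at once. The glued
    action satisfies both definitions, and [Phi] agrees with it by [is_Phi_unique], hence inherits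
    its recursion. *)
Lemma is_Phi_is_Phi' U Phi : open U -> is_Phi Sp U Phi -> is_Phi' Sp nabT U Phi.
Proof.
move=> oU H; have [hP _] := H; apply: recursive_is_Phi' => // k s sms.
have Hg := glued_action_recursive k oU sms.
have E t x : smooth_tens D U t -> U x -> Phi t s x = glued_action U t s x.
  move=> st Ux; have hg : is_Phi' Sp nabT U (glued_action U).
    apply: (recursive_is_Phi' oU (glued_tensor_action oU)) => k' s' sms'.
    exact: glued_action_recursive.
  exact: (is_Phi_unique oU H (is_Phi'_is_Phi oU hg) st sms Ux).
split.
- exact: tensor_action_tensorial.
- by move=> t st _; exact: (ta_smooth hP).
- by move=> f sf; exact: (ta_fun hP).
move=> Z Y sZ sY l lk dY x Ux; have [sB _] := sZ.
rewrite (E _ x (smooth_tmul oU (smooth_tvec oU sZ) sY) Ux) (recursive_rec Hg sZ sY lk dY Ux).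
rewrite (E _ x (tc_smooth hT oU sB sY) Ux); congr (_ - _).
have sg := recursive_smooth Hg sY (degle_leq (ltnW lk) dY).
apply: (A_op_ext oU sZ sZ sg (ta_smooth hP sY sms) (fun _ _ => erefl) _ Ux).
by move=> y Uy; rewrite E.
Qed.

(* On parallel tensors the derivative terms of the recursion vanish, so that
   [a |-> Phi (tmul a b) s] and [a |-> Phi a (Phi b s)] obey the same recursion. *)
Lemma is_Phi'_module U Phi : open U -> is_Phi' Sp nabT U Phi ->
  parallel_module Sp nabT U Phi.
Proof.
move=> oU H; have [hP _ _] := H.
have rec k s sms := @is_Phi'_recursive k U Phi s oU H sms.
have refl (v : @csec R n M m) : eq_on U v v by [].
have oS := @sp_open _ _ _ _ _ _ Sp.
split.
- by move=> a s [sa _] sms; exact: (ta_smooth hP).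
- by move=> s sms x Ux; have := ta_fun hP (csmooth_cst U 1) sms Ux; rewrite scale1r.
- move=> a b s [sa _] [sb pb] sms; have sPb := ta_smooth hP sb sms.
  have da := degle_tdegree sa; have db := degle_tdegree sb.
  set k := tdegree U a in da *; set l := tdegree U b in db *.
  have Hl := rec (k + l)%N s sms.
  suff H1 : recursive k U (Phi b s) (fun u => Phi (tmul u b) s).
    exact: (recursive_unique hT oU (refl _) sPb sPb H1 (rec k _ sPb) sa da).
  split.
  + split=> [t t' st st' _ _ tt|f t t' sf st st' _ _].
      apply: (ta_ext hP) => //; [exact: smooth_tmul|exact: smooth_tmul|].
      by move=> y Uy; apply: tmul_ext => //; exact: tt.
    have -> : tmul (tadd (tscale f t) t') b = tadd (tscale f (tmul t b)) (tmul t' b).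
      by apply/funext => x; apply/funext => w; rewrite tmul_lin_l.
    by apply: (ta_linear hP) => //; exact: smooth_tmul.
  + by move=> t st _; apply: (ta_smooth hP) => //; exact: smooth_tmul.
  + move=> f sf x Ux; rewrite tmul_tfunE.
    exact: (tensorial_scale (tensor_action_tensorial l hP sms) sf sb db Ux).
  move=> Z Y sZ sY q qk dY x Ux; have [sB _] := sZ.
  have sYb := smooth_tmul oU sY sb.
  have dYb : degle (q + l) U (tmul Y b) by exact: degle_tmul.
  have -> : tmul (tmul (tvec Z) Y) b = tmul (tvec Z) (tmul Y b).
    by apply/funext => y; apply/funext => w; rewrite tmulA.
  have ql : (q + l < k + l)%N by rewrite ltn_add2r.
  rewrite (recursive_rec Hl sZ sYb ql dYb Ux); congr (_ - _).
  have sn := tc_smooth hT oU sB sY; have snb := tc_smooth hT oU sB sYb.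
  apply: (ta_ext hP snb _ sms sms _ (refl s) Ux); first exact: smooth_tmul.
  move=> y Uy; rewrite (tc_leibniz hT oU sB sY sb Uy); apply/funext => w; rewrite /tadd.
  rewrite (tmul_ext (erefl (Y y)) (pb _ sB y Uy)).
  rewrite [X in _ + X](_ : _ = 0) ?addr0// /tmul big1// => c _; exact: mulr0.
- move=> z a b s [sa _] [sb _] sms.
  exact: (ta_linear hP (csmooth_cst U z) sa sb sms).
- move=> z a s s' [sa _] sms sms'; have da := degle_tdegree sa.
  set k := tdegree U a in da *.
  have sml := csmooth_sec_lin oS oU (csmooth_cst U z) sms sms'.
  have Hs := rec k _ sms; have Hs' := rec k _ sms'.
  (* Linearity in the spinor is again uniqueness: the combination obeys the recursion started at
     [z *: s + s'], because the constant [z] has derivative zero. *)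
  suff H1 : recursive k U (fun x => z *: s x + s' x) (fun u x => z *: Phi u s x + Phi u s' x).
    exact: (recursive_unique hT oU (refl _) sml sml (rec k _ sml) H1 sa da).
  split.
  + split=> [t t' st st' dt dt' tt x Ux|f t t' sf st st' dt dt' x Ux].
      rewrite (tensorial_ext (recursive_tensorial Hs) st st' dt dt' tt Ux).
      by rewrite (tensorial_ext (recursive_tensorial Hs') st st' dt dt' tt Ux).
    rewrite (tensorial_lin (recursive_tensorial Hs) sf st st' dt dt' Ux).
    rewrite (tensorial_lin (recursive_tensorial Hs') sf st st' dt dt' Ux).
    by rewrite !scalerDr !scalerA (mulrC z) addrACA.
  + move=> t st _; apply: csmooth_sec_lin => //; first exact: csmooth_cst.
      exact: (ta_smooth hP).
    exact: (ta_smooth hP).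
  + move=> f sf x Ux; rewrite (recursive_fun Hs sf Ux) (recursive_fun Hs' sf Ux).
    by rewrite scalerDr !scalerA (mulrC z).
  move=> Z Y sZ sY q qk dY x Ux.
  rewrite (recursive_rec Hs sZ sY qk dY Ux) (recursive_rec Hs' sZ sY qk dY Ux).
  have sP := ta_smooth hP sY sms; have sP' := ta_smooth hP sY sms'.
  rewrite (A_op_leibniz oU (csmooth_cst U z) sZ sP sP' Ux).
  by rewrite cact_cst scale0r add0r scalerBr opprD addrACA.
Qed.

End Global_action.

Theorem proposition3p3 (R : realType) (n r m : nat) (M : manifold R n)
    (D : @geometric_data R n M r) (Sp : spinor_data D m)
    (nabT : @csec R n M r -> @tfield R n M r -> @tfield R n M r)
    (hnabT : tensor_connection D nabT) (U : set M) (hU : open U) :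
  (exists Phi, is_Phi Sp U Phi) /\
  (exists Phi', is_Phi' Sp nabT U Phi') /\
  forall Phi Phi', is_Phi Sp U Phi -> is_Phi' Sp nabT U Phi' ->
    (forall t s, smooth_tens D U t -> csmooth_spinor Sp U s ->
       eq_on U (Phi t s) (Phi' t s)) /\
    (forall a s, parallel D nabT U a -> csmooth_spinor Sp U s ->
       eq_on U (Phi' a s) (Phi a s)) /\
    parallel_module Sp nabT U Phi /\
    parallel_module Sp nabT U Phi'.
Proof.
have H0 : is_Phi' Sp nabT U (glued_action Sp nabT U).
  apply: (recursive_is_Phi' hnabT hU (glued_tensor_action Sp hnabT hU)) => k s sms.
  exact: glued_action_recursive.
split; first by exists (glued_action Sp nabT U); exact: is_Phi'_is_Phi H0.
split; first by exists (glued_action Sp nabT U).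
(* The equality rests on this implication and on uniqueness; the converse implication serves the
   module structure of [Phi]. *)
move=> Phi Phi' hP hP'; have hP1 := is_Phi'_is_Phi hnabT hU hP'.
have E t s : smooth_tens D U t -> csmooth_spinor Sp U s ->
    eq_on U (Phi t s) (Phi' t s) by move=> st sms; exact: is_Phi_unique hU hP hP1 st sms.
split => //; split; first by move=> a s [sa _] sms x Ux; rewrite (E a s).
by split; apply: is_Phi'_module => //; exact: is_Phi_is_Phi'.
Qed.
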